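(* The sharp upper bound for the total complexity of a lasso with normalized data for $p=3$ is $6$: every lasso solution with normalized data with $p=3$ predictors has total number of segments at most $6$, and there is a lasso with normalized data with $p=3$ whose solution has total number of segments exactly $6$. This is smaller than $\bar N(3)=7$.
   Context: For $p=3$, a data set consists of $N$ points $(x_1^{(i)},x_2^{(i)},x_3^{(i)},y^{(i)})\in\mathbb R^{4}$ with centroid at the origin and not contained in any proper affine subspace (full rank assumption). Put $K=\frac1N\sum_i x^{(i)}(x^{(i)})^T$ (positive definite), $b=\frac1N\sum_i y^{(i)}x^{(i)}$, $\hat\beta=K^{-1}b$, $\hat t=\sum_j|\hat\beta_j|$. The data are normalized if $K_{jj}=1$ for $j=1,2,3$. For $t\ge0$ the lasso estimate $\beta(t)$ is the unique minimizer of $f(\beta)=\frac12\sum_i\big(y^{(i)}-\sum_j\beta_jx_j^{(i)}\big)^2$ over $\beta\in\mathbb R^3$ with $\sum_j|\beta_j|\le t$. The lasso solution (path) is the curve $t\mapsto\beta(t)$, $0\le t\le\hat t$, a polygonal chain from $\hat\beta$ to the origin. Its segments (of positive length) are the maximal portions along which the sign vector $(\operatorname{sgn}\beta_1,\operatorname{sgn}\beta_2,\operatorname{sgn}\beta_3)$ is constant. The total complexity (total number of segments) counts these segments plus the origin as one additional, degenerate, final segment. $\bar N(3)=\binom30h_{3,2}+\binom31h_{2,2}+2$, where $h_{k,2}$ is the maximal number of binary words of length $k$ such that every two of them match in at least two spots ($h_{2,2}=1$, $h_{3,2}=2$). *)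

(* Defs.v *)
From mathcomp Require Import all_boot all_order all_algebra.
From mathcomp Require Import all_classical all_reals all_analysis.

Set Implicit Arguments.
Unset Strict Implicit.
Unset Printing Implicit Defensive.

Import Order.TTheory GRing.Theory Num.Theory.

Local Open Scope classical_set_scope.
Local Open Scope ring_scope.

Section Lasso.
Variables (R : realType) (N p : nat).

(* Row i of X is the predictor vector x^(i) and y i 0 is the response y^(i). *)
Variables (X : 'M[R]_(N, p)) (y : 'cV[R]_N).

Definition data_point (i : 'I_N) : 'rV[R]_(p + 1) := row_mx (row i X) (row i y).

Definition centered : Prop := \sum_(i < N) data_point i = 0.

(* Affine subspaces of R^(p+1) are the translates v + V, with V the row space
   of a matrix; such a subspace is proper iff V is not the full space. *)
Definition full_rank_data : Prop :=
  forall (v : 'rV[R]_(p + 1)) (V : 'M[R]_(p + 1)),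
    (forall i, (data_point i - v <= V)%MS) -> row_full V.

Definition data_set : Prop := centered /\ full_rank_data.

Definition Kmat : 'M[R]_p :=
  N%:R^-1 *: \sum_(i < N) ((row i X)^T *m row i X).

Definition bvec : 'cV[R]_p := N%:R^-1 *: \sum_(i < N) (y i 0 *: (row i X)^T).

Definition beta_hat : 'cV[R]_p := invmx Kmat *m bvec.

Definition l1norm (beta : 'cV[R]_p) : R := \sum_(j < p) `|beta j 0|.

Definition t_hat : R := l1norm beta_hat.

Definition normalized : Prop := forall j, Kmat j j = 1.

Definition lasso_objective (beta : 'cV[R]_p) : R :=
  2^-1 * \sum_(i < N) (y i 0 - \sum_(j < p) beta j 0 * X i j) ^+ 2.

Definition lasso_minimizer (t : R) (beta : 'cV[R]_p) : Prop :=
  l1norm beta <= t /\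
  forall gamma : 'cV[R]_p, l1norm gamma <= t ->
    lasso_objective beta <= lasso_objective gamma.

(* The default value 0 is irrelevant: for t >= 0 and data satisfying
   [data_set] the minimizer exists and is unique. *)
Definition lasso (t : R) : 'cV[R]_p := xget 0 [set beta | lasso_minimizer t beta].

Definition sign_vector (beta : 'cV[R]_p) : 'cV[R]_p := map_mx Num.sg beta.

(* Portions of the path are given by their parameter intervals.  They
   correspond to the portions of the curve itself because t |-> lasso t is
   injective on [0, t_hat], the l1-norm of lasso t being t there.  In
   particular, a portion has positive length iff its parameter interval is
   not reduced to a point. *)
Definition constant_sign_portion (I : set R) : Prop :=
  [/\ is_interval I, I `<=` `[0, t_hat],
      exists s t, [/\ I s, I t & s < t] &
      forall s t, I s -> I t -> sign_vector (lasso s) = sign_vector (lasso t)].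

Definition lasso_segment (I : set R) : Prop :=
  constant_sign_portion I /\
  forall J : set R, constant_sign_portion J -> I `<=` J -> J = I.

(* The path has m segments of positive length, and the origin contributes one
   additional, degenerate segment. *)
Definition total_complexity (n : nat) : Prop :=
  exists2 m : nat, ([set I | lasso_segment I] #= `I_m)%card & n = m.+1.

End Lasso.

Definition matching_spots k (u v : k.-tuple bool) : nat :=
  #|[pred i : 'I_k | tnth u i == tnth v i]|.

Definition max_code (k l : nat) : nat :=
  \max_(W : {set k.-tuple bool} |
        [forall u in W, forall v in W, (u != v) ==> (l <= matching_spots u v)%N])
    #|W|.

Definition Nbar3 : nat :=
  ('C(3, 0) * max_code 3 2 + 'C(3, 1) * max_code 2 2 + 2)%N.

(* Main.v *)
Require Import Defs.
From mathcomp Require Import all_boot all_order all_algebra.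
From mathcomp Require Import all_classical all_reals all_analysis.
From mathcomp Require Import ring lra.

(** Write [r = b - K beta] for the vector of residual correlations.  A point
of the lasso path is characterized by the existence of [l >= 0] with
[|r_j| <= l] and [r_j beta_j = l |beta_j|] for all [j].  These conditions are
preserved by convex combinations of points with a common sign vector, so every
nonzero sign vector is used on a single interval, and the segments of the path
correspond to the sign vectors that occur at two different points.

For [p = 3], put [v = beta - gamma] for two points of the path, so that [K v]
is the difference of their residual correlations.  Using that [K] is positive
definite with unit diagonal, one gets:
- two sign vectors cannot be opposite in two coordinates, nor opposite in one
  coordinate and both zero in another one.  Hence at most two full sign vectors
  occur, and at most one sign vector for each support of size 2;
- only one sign vector with a single nonzero coordinate occurs;
- if two full sign vectors occur, say differing in the first coordinate, then
  [1 + K_23 < |K_12 + K_13|], and this forbids that both supports {1,3} and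
  {1,2} occur.
This leaves at most 5 nonzero sign vectors.  The bound is attained for
[K_12 = K_13 = 2/3], [K_23 = 0] and [b = (17, 16, 13)], where the path has the
vertices (0,0,0), (3,0,0), (6,3,0), (0,9,6), (0,15,12), (-21,30,27). *)

Set Implicit Arguments.
Unset Strict Implicit.
Unset Printing Implicit Defensive.

Import Order.TTheory GRing.Theory Num.Theory.
Import numFieldNormedType.Exports.

(** * Codes and sign patterns *)

Section Combinatorics.
Local Open Scope nat_scope.

Lemma matching_spots_lt k (u v : k.-tuple bool) : u != v ->
  matching_spots u v < k.
Proof.
move=> uv; rewrite -[ltnRHS]card_ord ltn_neqAle max_card andbT.
apply: contra uv => /eqP e; apply/eqP/eq_from_tnth => i; apply/eqP.
have /subset_cardP/(_ (subset_predT _)) := e.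
by move/(_ i); rewrite !inE.
Qed.

Lemma matching_spots3 (u v : 3.-tuple bool) : matching_spots u v =
  (tnth u 0%R == tnth v 0%R) + (tnth u 1%R == tnth v 1%R)
  + (tnth u 2%R == tnth v 2%R).
Proof.
transitivity (\sum_(i < 3) (tnth u i == tnth v i : nat)).
  by rewrite /matching_spots -sum1_card big_mkcond; apply: eq_bigr => i _;
    rewrite inE; case: eqP.
rewrite !big_ord_recl big_ord0 addn0 addnA.
have -> : lift ord0 ord0 = 1%R :> 'I_3 by exact: val_inj.
by have -> : lift ord0 (lift ord0 ord0) = 2%R :> 'I_3 by exact: val_inj.
Qed.

(** Distinct words in such a code differ in exactly one spot. Three words cannot be pairwise at
    Hamming distance 1, since the distances around a triangle have an even sum; the nine bits are
    checked exhaustively. *)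
Lemma max_code32_le : max_code 3 2 <= 2.
Proof.
apply/bigmax_leqP => W /forall_inP codeW; rewrite leqNgt; apply/negP.
move=> /card_gt2P[u [v [w [[uW vW wW] [uv vw wu]]]]].
have code a b : a \in W -> b \in W -> a != b -> matching_spots a b = 2.
  move=> aW bW ab; apply/eqP; rewrite eqn_leq -ltnS matching_spots_lt //=.
  by have /forall_inP/(_ b bW)/implyP := codeW a aW; apply.
have := code _ _ uW vW uv; have := code _ _ vW wW vw; have := code _ _ wW uW wu.
rewrite !matching_spots3.
move: (tnth u 0%R) (tnth u 1%R) (tnth u 2%R) (tnth v 0%R) (tnth v 1%R) (tnth v
  2%R).
move: (tnth w 0%R) (tnth w 1%R) (tnth w 2%R).
by do 9!case.
Qed.

Lemma max_code32 : max_code 3 2 = 2.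
Proof.
apply/eqP; rewrite eqn_leq max_code32_le /=.
pose u := [tuple true; true; true]; pose v := [tuple true; true; false].
apply: (@leq_trans #|[set u; v]|); first by rewrite cards2.
rewrite /max_code; apply: (@leq_bigmax_cond _ _ (fun W : {set 3.-tuple bool} =>
  #|W|)).
apply/forall_inP => a; rewrite !inE => /orP[] /eqP ->;
  by apply/forall_inP => b; rewrite !inE => /orP[] /eqP ->;
    rewrite matching_spots3.
Qed.

Lemma max_code22 : max_code 2 2 = 1.
Proof.
apply/eqP; rewrite eqn_leq; apply/andP; split.
  apply/bigmax_leqP => W /forall_inP codeW; apply/card_le1_eqP => u v uW vW.
  apply/eqP; apply: contraT => uv.
  have /forall_inP/(_ u uW)/implyP/(_ uv) := codeW v vW.
  by rewrite leqNgt matching_spots_lt.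
apply: (@leq_trans #|[set [tuple true; true]]|); first by rewrite cards1.
rewrite /max_code; apply: (@leq_bigmax_cond _ _ (fun W : {set 2.-tuple bool} =>
  #|W|)).
apply/forall_inP => u; rewrite inE => /eqP ->; apply/forall_inP => v;
  rewrite inE => /eqP ->.
by rewrite eqxx.
Qed.

Lemma Nbar3E : Nbar3 = 7.
Proof. by rewrite /Nbar3 max_code32 max_code22. Qed.

Lemma uniq3_mem (i j k l : 'I_3) : uniq [:: i; j; k] -> l \in [:: i; j; k].
Proof.
move=> ijk; apply: contraT => nl.
have /card_uniqP e : uniq [:: l; i; j; k] by rewrite cons_uniq nl.
by have := max_card (mem [:: l; i; j; k]); rewrite e card_ord.
Qed.

Lemma uniq3_third (i j : 'I_3) : i != j -> exists k, uniq [:: i; j; k].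
Proof.
move=> ij; have /card_uniqP e : uniq [:: i; j] by rewrite /= inE ij.
have : 0 < #|[predC (mem [:: i; j])]|.
  by rewrite -(ltn_add2l #|[:: i; j]|) cardC addn0 e card_ord.
case/card_gt0P=> k; rewrite !inE negb_or => /andP[ki kj]; exists k.
by rewrite /= !inE negb_or ij (eq_sym i) ki (eq_sym j) kj.
Qed.

Lemma uniq3_others (i : 'I_3) : exists j k, uniq [:: i; j; k].
Proof.
have : exists j, i != j by case: (eqVneq i 0%R) => [->|?];
  [exists 1%R|exists 0%R].
by case=> j /uniq3_third[k ?]; exists j, k.
Qed.

Lemma forall3 (P : pred 'I_3) i j k : uniq [:: i; j; k] ->
  [forall l, P l] = [&& P i, P j & P k].
Proof.
move=> ijk; apply/forallP/and3P => [h|[Pi Pj Pk] l]; first by split.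
by have := uniq3_mem l ijk; rewrite !inE => /or3P[] /eqP ->.
Qed.

(** A sign is encoded as [None] for zero, [Some true] for positive and [Some false] for negative, so
    that the coercion to [bool] tests for being nonzero. A clash is a pair of opposite nonzero
    signs. *)
Definition clash (u v : option bool) : bool := [&& u : bool, v : bool & u != v].

(** * Counting sign patterns on three coordinates under exclusion rules *)

Section SignCodes.
Variable A : {set {ffun 'I_3 -> option bool}}.

(** These rules isolate what the optimality conditions imply about signs; [attained_clash],
    [attained_single] and [attained_pairs] establish the last three for the lasso path. *)
Hypothesis A_neq0 : forall c, c \in A -> [exists i, (c i : bool)].
Hypothesis A_clash : forall c d i j k, c \in A -> d \in A -> uniq [:: i; j;
  k] ->
  clash (c j) (d j) -> clash (c k) (d k) || ~~ c k && ~~ d k -> False.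
Hypothesis A_single : forall c d i j k, c \in A -> d \in A -> uniq [:: i; j;
  k] ->
  [&& c i : bool, ~~ c j & ~~ c k] -> [&& ~~ d i, d j : bool & ~~ d k] -> False.
Hypothesis A_pairs : forall c d e f i j k, c \in A -> d \in A -> e \in A ->
  f \in A ->
  uniq [:: i; j; k] -> clash (c i) (d i) ->
  (c j : bool) -> c j = d j -> (c k : bool) -> c k = d k ->
  [&& e i : bool, ~~ e j & e k : bool] ->
    [&& f i : bool, f j : bool & ~~ f k] -> False.

Let singles := [set c in A | [exists i, [forall j, (c j : bool) == (j == i)]]].
Let pairs i := [set c in A | [forall j, (c j : bool) == (j != i)]].
Let fulls := [set c in A | [forall j, (c j : bool)]].

Lemma uniq3_rot (i j k : 'I_3) : uniq [:: i; j; k] -> uniq [:: j; k; i].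
Proof. by rewrite -(rot_uniq 1). Qed.

Lemma uniq3_neq (i j k : 'I_3) : uniq [:: i; j; k] ->
  [/\ (i == j) = false, (i == k) = false, (j == k) = false,
      (j == i) = false & ((k == i) = false) * ((k == j) = false)]%type.
Proof.
rewrite /= !inE negb_or => /and3P[/andP[/negbTE ij /negbTE ik] /negbTE jk _].
by rewrite ![_ == i]eq_sym (eq_sym k j) ij ik jk.
Qed.

Lemma ffun3P (c d : {ffun 'I_3 -> option bool}) i j k : uniq [:: i; j; k] ->
  c i = d i -> c j = d j -> c k = d k -> c = d.
Proof.
move=> ijk ci cj ck; apply/ffunP => l.
by have := uniq3_mem l ijk; rewrite !inE => /or3P[] /eqP ->.
Qed.

Lemma none_eq (u v : option bool) : ~~ u -> ~~ v -> u = v.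
Proof. by case: u; case: v. Qed.

(** Distinct patterns with the same singleton support clash there and vanish at both other
    coordinates, against [A_clash]; different supports are excluded by [A_single]. *)
Lemma card_singles : #|singles| <= 1.
Proof.
apply/card_le1_eqP => c d;
  rewrite !inE => /andP[cA /existsP[i ci]] /andP[dA /existsP[i' di]].
have [ii'|ii'] := eqVneq i i'.
  have [j [k ijk]] := uniq3_others i;
    have [ij ik jk ji [ki kj]] := uniq3_neq ijk.
  subst i'; move: ci di; rewrite !(forall3 _ ijk) eqxx ji ki !eqbF_neg !eqb_id.
  move=> /and3P[ci cj ck] /and3P[di dj dk].
  have [e|e] := eqVneq (c i) (d i).
    by apply: (ffun3P ijk) => //; exact: none_eq.
  exfalso; apply: (A_clash cA dA (uniq3_rot (uniq3_rot ijk))).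
    by rewrite /clash ci di e.
  by rewrite cj dj orbT.
have [k ijk] := uniq3_third ii'; have [ij ik jk ji [ki kj]] := uniq3_neq ijk.
move: ci di; rewrite !(forall3 _ ijk) !eqxx ij ji ki kj !eqbF_neg !eqb_id => ci
  di.
by exfalso; apply: (A_single cA dA ijk).
Qed.

(** Both patterns vanish at [i], so by [A_clash] a single disagreement elsewhere is already
    impossible. *)
Lemma card_pairs i : #|pairs i| <= 1.
Proof.
apply/card_le1_eqP => c d; rewrite !inE => /andP[cA ci] /andP[dA di].
have [j [k ijk]] := uniq3_others i; have [ij ik jk ji [ki kj]] := uniq3_neq ijk.
move: ci di; rewrite !(forall3 _ ijk) eqxx ji ki /= !eqbF_neg !eqb_id.
move=> /and3P[ci cj ck] /and3P[di dj dk].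
have [ej|ej] := eqVneq (c j) (d j); last first.
  exfalso; apply: (A_clash cA dA (_ : uniq [:: k; j; i])).
  - by rewrite -rev_uniq.
  - by rewrite /clash cj dj ej.
  - by rewrite ci di orbT.
have [ek|ek] := eqVneq (c k) (d k); last first.
  exfalso; apply: (A_clash cA dA (uniq3_rot ijk)).
    by rewrite /clash ck dk ek.
  by rewrite ci di orbT.
by apply: (ffun3P ijk) => //; exact: none_eq.
Qed.

Lemma fulls_clash c d i j : c \in fulls -> d \in fulls -> i != j ->
  c i != d i -> c j = d j.
Proof.
rewrite !inE => /andP[cA /forallP cs] /andP[dA /forallP ds] ij ci; apply/eqP.
apply: contraT => cj; exfalso; have [k ijk] := uniq3_third ij.
by apply: (A_clash cA dA (uniq3_rot (uniq3_rot ijk)));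
  rewrite /clash !cs !ds ?ci ?cj.
Qed.

(** Full patterns are binary words of length 3. By [fulls_clash] two of them differ in at most one
    spot, so they form a code counted by [max_code 3 2]. *)
Lemma card_fulls : #|fulls| <= 2.
Proof.
pose word (c : {ffun 'I_3 -> option bool}) := [tuple c i == Some true | i < 3].
have wordP c d i : c \in fulls -> d \in fulls ->
    (tnth (word c) i == tnth (word d) i) = (c i == d i).
  rewrite !inE !tnth_mktuple => /andP[_ /forallP/(_ i)] + /andP[_ /forallP/(_
    i)].
  by case: (c i) => // -[]; case: (d i) => // -[].
have word_inj : {in fulls &, injective word}.
  move=> c d cF dF e; apply/ffunP => i; apply/eqP.
  by rewrite -wordP // e.
rewrite -(card_in_imset word_inj); apply: leq_trans max_code32_le.
rewrite /max_code; apply: (@leq_bigmax_cond _ _ (fun W : {set 3.-tuple bool} =>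
  #|W|)).
apply/forall_inP => _ /imsetP[c cF ->]; apply/forall_inP => _ /imsetP[d dF ->].
apply/implyP => cd; rewrite leqNgt; apply/negP => lt2.
have : 1 < #|[predC [pred i | tnth (word c) i == tnth (word d) i]]|.
  move: lt2; rewrite /matching_spots; set m := #|_|; set n := #|_|.
  have : m + n = 3 by rewrite /m /n cardC card_ord.
  by move=> mn m2; rewrite -(ltn_add2l m) mn addn1.
move=> /card_gt1P[i [j]]; rewrite !inE !wordP // => -[ci cj ij].
by move: cj; rewrite (fulls_clash cF dF ij ci) eqxx.
Qed.

(** With at most one full pattern the count is 1 + 3 + 1. Two full patterns differing at [i] leave
    room for only one of the supports {i,k} and {i,j}, and the count is 1 + 2 + 2. *)
Lemma card_sign_codes : #|A| <= 5.
Proof.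
have cover i j k : uniq [:: i; j; k] ->
    #|A| <= #|singles| + (#|pairs i| + #|pairs j| + #|pairs k|) + #|fulls|.
  move=> ijk; have [ij ik jk ji [ki kj]] := uniq3_neq ijk.
  apply: (@leq_trans #|singles :|: (pairs i :|: pairs j :|: pairs k) :|:
    fulls|).
    apply: subset_leq_card; apply/fintype.subsetP => c cA; rewrite !inE cA /=.
    have := A_neq0 cA; rewrite -[[exists i, (c i : bool)]]negbK negb_exists
      !(forall3 _ ijk).
    (* The existential is turned into a negated universal so that [forall3] reduces everything to a
       truth table in [c i], [c j], [c k]. *)
    have -> : [exists l, [forall m, (c m : bool) == (m == l)]] =
      ~~ [forall l, ~~ [&& (c i : bool) == (i == l), (c j : bool) == (j == l)
                          & (c k : bool) == (k == l)]].
      by rewrite negb_forall; apply: eq_existsb => l;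
        rewrite negbK (forall3 _ ijk).
    rewrite (forall3 _ ijk) !eqxx ij ik jk ji ki kj /=.
    by case: (c i); case: (c j); case: (c k).
  apply: leq_trans (leq_card_setU _ _) _; rewrite leq_add2r.
  apply: leq_trans (leq_card_setU _ _) _; rewrite leq_add2l.
  by apply: leq_trans (leq_card_setU _ _) _; rewrite leq_add2r leq_card_setU.
have [fulls1|/card_gt1P[c [d [cF dF cd]]]] := leqP #|fulls| 1.
  have [j [k ijk]] := uniq3_others 0%R.
  apply: leq_trans (cover _ _ _ ijk) _.
  by rewrite (leq_add (leq_add card_singles (leq_add (leq_add (card_pairs _)
    (card_pairs _)) (card_pairs _))) fulls1).
have [i ci] : exists i, c i != d i.
  apply/existsP; apply: contraT; rewrite negb_exists => /forallP e; move: cd.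
  by move=> /eqP[]; apply/ffunP => i; apply/eqP; have := e i; rewrite negbK.
have [j [k ijk]] := uniq3_others i; have [ij ik jk ji [ki kj]] := uniq3_neq ijk.
have ej := fulls_clash cF dF (negbT ij) ci;
  have ek := fulls_clash cF dF (negbT ik) ci.
apply: leq_trans (cover _ _ _ ijk) _.
have jk1 : #|pairs j| + #|pairs k| <= 1.
  have [->|/card_gt0P[e]] := posnP #|pairs j|; first exact: card_pairs.
  have [->|/card_gt0P[f]] := posnP #|pairs k|;
    first by rewrite addn0 card_pairs.
  move: cF dF; rewrite !inE !(forall3 _ ijk) !eqxx ij ik jk kj /= !eqb_id
    !eqbF_neg.
  move=> /andP[cA /and3P[ci' cj ck]] /andP[dA /and3P[di' dj dk]] /andP[fA fs]
    /andP[eA es].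
  by exfalso; apply: (A_pairs cA dA eA fA ijk); rewrite /clash ?ci' ?di'.
by rewrite -(addnA #|pairs i|) (leq_add (leq_add card_singles (leq_add
  (card_pairs i) jk1)) card_fulls).
Qed.

End SignCodes.

End Combinatorics.

Local Open Scope classical_set_scope.
Local Open Scope ring_scope.

(** * Optimality conditions for three predictors *)

Section CorrelationMatrix.
Variable R : realType.
Implicit Types a b c x y z l m r s v T : R.

(** This says that [r] is [l] times a subgradient of the absolute value at [x]. *)
Definition kkt_coord l x r : Prop := `|r| <= l /\ r * x = l * `|x|.

Lemma kkt_coordN l x r : kkt_coord l x r -> kkt_coord l (- x) (- r).
Proof. by rewrite /kkt_coord !normrN mulrNN. Qed.

Lemma kkt_coord_gt0 l x r : kkt_coord l x r -> 0 < x -> r = l.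
Proof.
move=> [_ e] x0; move: e; rewrite (gtr0_norm x0) => /mulIf -> //.
by rewrite gt_eqF.
Qed.

Lemma kkt_coord_lt0 l x r : kkt_coord l x r -> x < 0 -> r = - l.
Proof.
move=> /kkt_coordN kx x0; rewrite -(kkt_coord_gt0 kx) ?opprK //.
by rewrite oppr_gt0.
Qed.

(** Up to sign x > 0 > y, which forces r = l and s = - m. In applications the left side is v_j (K
    v)_j for the difference v of two path points. *)
Lemma kkt_coord_clash l m x y r s : kkt_coord l x r -> kkt_coord m y s ->
  x * y < 0 -> (x - y) * (s - r) = - (l + m) * `|x - y|.
Proof.
wlog x_gt0 : x y r s / 0 < x => [H|].
  have [xN|x_gt0|->] := ltgtP x 0; last by rewrite mul0r ltxx.
    move=> /kkt_coordN kx /kkt_coordN ky xy.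
    have := H (- x) (- y) (- r) (- s);
      rewrite oppr_gt0 mulrNN => /(_ xN kx ky xy).
    by rewrite -!opprD mulrNN normrN.
  exact: H x_gt0.
rewrite pmulr_rlt0 // => kx ky y_lt0.
rewrite (kkt_coord_gt0 kx) // (kkt_coord_lt0 ky) // gtr0_norm; last lra.
ring.
Qed.

(** Positive definiteness of the symmetric matrix with unit diagonal and entries K12 = a, K13 = b,
    K23 = c. The sign flips and transpositions that follow serve to normalize signs and
    positions. *)
Definition posdef3 a b c : Prop := forall x y z, [|| x != 0, y != 0 | z != 0] ->
  0 < x ^+ 2 + y ^+ 2 + z ^+ 2 + 2 * (a * x * y + b * x * z + c * y * z).

Lemma posdef3_flip1 a b c : posdef3 a b c -> posdef3 (- a) (- b) c.
Proof.
move=> pd x y z nz; have := pd (- x) y z; rewrite oppr_eq0 => /(_ nz).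
by congr (0 < _); ring.
Qed.

Lemma posdef3_flip2 a b c : posdef3 a b c -> posdef3 (- a) b (- c).
Proof.
move=> pd x y z nz; have := pd x (- y) z; rewrite oppr_eq0 => /(_ nz).
by congr (0 < _); ring.
Qed.

Lemma posdef3_swap a b c : posdef3 a b c -> posdef3 b a c.
Proof.
move=> pd x y z nz; have := pd x z y; rewrite (orbC (z != 0)) => /(_ nz).
by congr (0 < _); ring.
Qed.

Lemma posdef3_swap12 a b c : posdef3 a b c -> posdef3 a c b.
Proof.
move=> pd x y z nz; have := pd y x z; rewrite orbCA => /(_ nz).
by congr (0 < _); ring.
Qed.

Lemma posdef3_bound a b c : posdef3 a b c ->
  [/\ -1 < a < 1, -1 < b < 1 & -1 < c < 1].
Proof.
move=> pd.
have pa1 := pd 1 1 0; have pa2 := pd 1 (-1) 0.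
have pb1 := pd 1 0 1; have pb2 := pd 1 0 (-1).
have pc1 := pd 0 1 1; have pc2 := pd 0 1 (-1).
rewrite oner_eq0 /= in pa1 pa2 pb1 pb2.
rewrite oner_eq0 eqxx /= in pc1 pc2.
move: (pa1 isT) (pa2 isT) (pb1 isT) (pb2 isT) (pc1 isT) (pc2 isT) => {pa1 pa2
  pb1 pb2 pc1 pc2}.
by move=> *; split; lra.
Qed.

(** The form is evaluated at the first column u of the adjugate: K u = det(K) e1, so its value is (1
    - c^2) det(K). *)
Lemma posdef3_det a b c : posdef3 a b c ->
  0 < 1 + 2 * a * b * c - a ^+ 2 - b ^+ 2 - c ^+ 2.
Proof.
move=> pd; have [_ _ c1] := posdef3_bound pd.
have c2 : 0 < 1 - c ^+ 2 by nra.
have := pd (1 - c ^+ 2) (b * c - a) (a * c - b).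
rewrite (gt_eqF c2) /= => /(_ isT) h.
rewrite -(pmulr_rgt0 _ c2).
by move: h; congr (0 < _); ring.
Qed.

(* The conditions for minimizing [1/2 <x, K x> - <d, x> + l |x|_1], where K is
   the matrix with unit diagonal and off-diagonal entries
   [K12 = a], [K13 = b], [K23 = c]. *)
Definition kkt3 a b c d1 d2 d3 l x1 x2 x3 : Prop :=
  [/\ kkt_coord l x1 (d1 - (x1 + a * x2 + b * x3)),
      kkt_coord l x2 (d2 - (a * x1 + x2 + c * x3)) &
      kkt_coord l x3 (d3 - (b * x1 + c * x2 + x3))].

Lemma kkt3_flip1 a b c d1 d2 d3 l x1 x2 x3 : kkt3 a b c d1 d2 d3 l x1 x2 x3 ->
  kkt3 (- a) (- b) c (- d1) d2 d3 l (- x1) x2 x3.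
Proof.
case=> /kkt_coordN k1 k2 k3; split.
- by move: k1; congr kkt_coord; ring.
- by move: k2; congr kkt_coord; ring.
- by move: k3; congr kkt_coord; ring.
Qed.

Lemma kkt3_flip2 a b c d1 d2 d3 l x1 x2 x3 : kkt3 a b c d1 d2 d3 l x1 x2 x3 ->
  kkt3 (- a) b (- c) d1 (- d2) d3 l x1 (- x2) x3.
Proof.
case=> k1 /kkt_coordN k2 k3; split.
- by move: k1; congr kkt_coord; ring.
- by move: k2; congr kkt_coord; ring.
- by move: k3; congr kkt_coord; ring.
Qed.

Lemma kkt3_swap a b c d1 d2 d3 l x1 x2 x3 : kkt3 a b c d1 d2 d3 l x1 x2 x3 ->
  kkt3 b a c d1 d3 d2 l x1 x3 x2.
Proof.
case=> k1 k2 k3; split.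
- by move: k1; congr kkt_coord; ring.
- by move: k3; congr kkt_coord; ring.
- by move: k2; congr kkt_coord; ring.
Qed.

Lemma kkt3_swap12 a b c d1 d2 d3 l x1 x2 x3 : kkt3 a b c d1 d2 d3 l x1 x2 x3 ->
  kkt3 a c b d2 d1 d3 l x2 x1 x3.
Proof.
case=> k1 k2 k3; split.
- by move: k2; congr kkt_coord; ring.
- by move: k1; congr kkt_coord; ring.
- by move: k3; congr kkt_coord; ring.
Qed.

(* Let v = x - y, w = (0, v2, v3), k = <e1, K w> and r = K v.  Then
   <w - k e1, K (w - k e1)> = v2 r2 + v3 r3 - k r1, and |k| <= |v2| + |v3|. *)
Lemma kkt3_clash a b c d1 d2 d3 l x1 x2 x3 m y1 y2 y3 : posdef3 a b c ->
  kkt3 a b c d1 d2 d3 l x1 x2 x3 -> kkt3 a b c d1 d2 d3 m y1 y2 y3 ->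
  x2 * y2 < 0 -> x3 * y3 < 0 \/ x3 = 0 /\ y3 = 0 -> False.
Proof.
move=> pd [[r1 _] kx2 kx3] [[s1 _] ky2 ky3] xy2 xy3.
have := kkt_coord_clash kx2 ky2 xy2.
have : (x3 - y3) * ((d3 - (b * y1 + c * y2 + y3)) - (d3 - (b * x1 + c * x2 +
  x3)))
    = - (l + m) * `|x3 - y3|.
  case: xy3 => [|[-> ->]]; first exact: kkt_coord_clash.
  by rewrite subrr normr0 mul0r mulr0.
set r3 := (_ - _ - _); set r2 := (_ - _ - _) => e3 e2.
have v2_neq0 : x2 - y2 != 0.
  by rewrite subr_eq0; apply: contraTneq xy2 => ->;
    rewrite -leNgt -expr2 sqr_ge0.
set v1 := x1 - y1 in r2 r3 e2 e3; set v2 := x2 - y2 in e2 v2_neq0;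
  set v3 := x3 - y3 in e3.
pose r := v1 + a * v2 + b * v3.
have rT : `|r| <= l + m.
  have -> : r = (d1 - (y1 + a * y2 + b * y3)) - (d1 - (x1 + a * x2 + b * x3)).
    by rewrite /r /v1 /v2 /v3; ring.
  by apply: le_trans (ler_normB _ _) _; rewrite addrC lerD.
have [a1 b1 _] := posdef3_bound pd.
pose k := a * v2 + b * v3.
have kv : `|k| <= `|v2| + `|v3|.
  apply: (le_trans (ler_normD _ _)); rewrite !normrM.
  apply: lerD; rewrite ler_piMl ?normr_ge0 // ler_norml; lra.
have krT : - (k * r) <= (l + m) * (`|v2| + `|v3|).
  apply: le_trans (ler_norm _) _; rewrite normrN normrM mulrC.
  by apply: ler_pM.
have := pd (- k) v2 v3; rewrite v2_neq0 orbT => /(_ isT).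
have -> : (- k) ^+ 2 + v2 ^+ 2 + v3 ^+ 2 +
    2 * (a * (- k) * v2 + b * (- k) * v3 + c * v2 * v3) =
    v2 * r2 + v3 * r3 - k * r.
  by rewrite /k /r /r2 /r3 /v1 /v2 /v3; ring.
(* The first two terms add up to - (l + m)(|v2| + |v3|), which [krT] shows to be at most k r,
   contradicting positivity. *)
rewrite e2 e3; lra.
Qed.

(** For x, y > 0 the conditions give d2 <= d1 - (1 - a) x and d1 <= d2 - (1 - a) y; their sum
    contradicts a < 1. Flips reduce to these signs. *)
Lemma kkt3_singletons a b c d1 d2 d3 l x m y : posdef3 a b c -> x != 0 ->
  y != 0 ->
  kkt3 a b c d1 d2 d3 l x 0 0 -> kkt3 a b c d1 d2 d3 m 0 y 0 -> False.
Proof.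
wlog x_gt0 : a b d1 x / 0 < x => [H|].
  move=> pd x0 y0; case/lt_total/orP: (x0) => [xN|x_gt0];
    last exact: (H a b d1 x x_gt0).
  move=> /kkt3_flip1 kx /kkt3_flip1; rewrite oppr0.
  by apply: H kx; rewrite ?oppr_gt0 ?oppr_eq0 //; exact: posdef3_flip1.
wlog y_gt0 : a c d2 y / 0 < y => [H|].
  move=> pd x0 y0; case/lt_total/orP: (y0) => [yN|y_gt0];
    last exact: (H a c d2 y y_gt0).
  move=> /kkt3_flip2; rewrite oppr0 => kx /kkt3_flip2.
  by apply: H kx; rewrite ?oppr_gt0 ?oppr_eq0 //; exact: posdef3_flip2.
move=> /posdef3_bound[a1 _ _] _ _.
move=> [/kkt_coord_gt0 /(_ x_gt0) e1 [/ler_normlP[_ q] _] _].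
move=> [[/ler_normlP[_ p] _] /kkt_coord_gt0 /(_ y_gt0) e2 _].
have : 0 < (1 - a) * (x + y) by apply: mulr_gt0; lra.
lra.
Qed.

(* det(K) (x1 - y1) = (1 - c) (- (1 + c) (m + l) - (a + b) (m - l)) when
   x and y have signs (+,+,+) and (-,+,+). *)
Lemma kkt3_full_corr a b c d1 d2 d3 l x1 x2 x3 m y1 y2 y3 : posdef3 a b c ->
  kkt3 a b c d1 d2 d3 l x1 x2 x3 -> kkt3 a b c d1 d2 d3 m y1 y2 y3 ->
  x1 * y1 < 0 -> 0 < x2 -> 0 < y2 -> 0 < x3 -> 0 < y3 -> 1 + c < `|a + b|.
Proof.
wlog x_gt0 : a b d1 x1 y1 / 0 < x1 => [H|].
  move=> pd kx ky xy; have x0 : x1 != 0 by apply: contraTneq xy => ->;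
    rewrite mul0r ltxx.
  case/lt_total/orP: x0 => [xN|x_gt0]; last exact: (H _ _ _ _ _ x_gt0 pd kx ky).
  rewrite -normrN opprD;
    apply: (H _ _ _ _ _ _ _ (kkt3_flip1 kx) (kkt3_flip1 ky)).
  - by rewrite oppr_gt0.
  - exact: posdef3_flip1.
  - by rewrite mulrNN.
move=> pd [kx1 kx2 kx3] [ky1 ky2 ky3]; rewrite pmulr_rlt0 // => y_lt0.
move=> x2_gt0 y2_gt0 x3_gt0 y3_gt0.
have [_ _ c1] := posdef3_bound pd; have det := posdef3_det pd.
have l0 : 0 <= l by case: kx1 => /(le_trans (normr_ge0 _)).
have m0 : 0 <= m by case: ky1 => /(le_trans (normr_ge0 _)).
have := mulr_gt0 det (_ : 0 < x1 - y1).
have -> : (1 + 2 * a * b * c - a ^+ 2 - b ^+ 2 - c ^+ 2) * (x1 - y1) =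
  (1 - c) * (- (1 + c) * (m + l) - (a + b) * (m - l)).
  have := kkt_coord_gt0 kx1 x_gt0; have := kkt_coord_lt0 ky1 y_lt0.
  have := kkt_coord_gt0 kx2 x2_gt0; have := kkt_coord_gt0 ky2 y2_gt0.
  have := kkt_coord_gt0 kx3 x3_gt0; have := kkt_coord_gt0 ky3 y3_gt0.
  move=> f3 e3 f2 e2 f1 e1.
  (* The coefficients are the first row of the adjugate, applied to the residual difference K (x -
     y). *)
  transitivity ((1 - c ^+ 2) * ((d1 - (y1 + a * y2 + b * y3)) - (d1 - (x1 + a *
    x2 + b * x3)))
      + (b * c - a) * ((d2 - (a * y1 + y2 + c * y3)) - (d2 - (a * x1 + x2 + c *
          x3)))
      + (a * c - b) * ((d3 - (b * y1 + c * y2 + y3)) - (d3 - (b * x1 + c * x2 +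
          x3)))).
    ring.
  rewrite f1 f2 f3 e1 e2 e3; ring.
rewrite pmulr_rgt0; last lra.
(* If |a + b| <= 1 + c, the positive factor would be at most (1 + c)(|m - l| - (m + l)) <= 0. *)
move=> /(_ ltac:(lra)) h; rewrite ltNge; apply/negP => /ler_normlP[h1 h2].
have : 0 <= (1 + c) * (m + l) by apply: mulr_ge0; lra.
case: (lerP l m) => lm.
  have : (- (a + b)) * (m - l) <= (1 + c) * (m - l) by apply: ler_wpM2r; lra.
  have : 0 <= (1 + c) * l by apply: mulr_ge0; lra.
  lra.
have : (a + b) * (l - m) <= (1 + c) * (l - m) by apply: ler_wpM2r; lra.
have : 0 <= (1 + c) * m by apply: mulr_ge0; lra.
lra.
Qed.

(** A flip of the first coordinate gives 1 + c < a + b, which makes a - bc, b - ac and ab - c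
    positive. Eliminating one coordinate from K (x - y) then yields an equation with sides of
    incompatible sign, for each choice of signs of [x1] and [y1]. *)
Lemma kkt3_pairs a b c d1 d2 d3 l x1 x3 m y1 y2 :
  posdef3 a b c -> 1 + c < `|a + b| ->
  kkt3 a b c d1 d2 d3 l x1 0 x3 -> kkt3 a b c d1 d2 d3 m y1 y2 0 ->
  x1 != 0 -> y1 != 0 -> 0 < x3 -> 0 < y2 -> False.
Proof.
wlog cab : a b d1 x1 y1 / 1 + c < a + b => [H|].
  move=> pd; rewrite lter_normr => /orP[cab|cab] kx ky x0 y0.
    by apply: (H _ _ _ _ _ cab pd _ kx ky) => //; rewrite lter_normr cab.
  apply: (H _ _ _ _ _ _ _ _ (kkt3_flip1 kx) (kkt3_flip1 ky)).
  - by rewrite -opprD.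
  - exact: posdef3_flip1.
  - by rewrite lter_normr -opprD cab.
  - by rewrite oppr_eq0.
  - by rewrite oppr_eq0.
move=> pd _ [kx [/ler_normlP[r2l r2l'] _] kx3] [ky ky2 [/ler_normlP[s3m s3m']
  _]].
move=> x0 y0 x3_gt0 y2_gt0.
move: (kkt_coord_gt0 kx3 x3_gt0) (kkt_coord_gt0 ky2 y2_gt0) => {kx3 ky2} ex3
  ey2.
have [a1 b1 c1] := posdef3_bound pd.
have a_gt : 0 < a - b * c.
  have : 0 < (1 + c) * (1 - b) by apply: mulr_gt0; lra.
  lra.
have b_gt : 0 < b - a * c.
  have : 0 < (1 + c) * (1 - a) by apply: mulr_gt0; lra.
  lra.
have c_lt : 0 < a * b - c.
  have : 0 < (1 - a) * (1 - b) by apply: mulr_gt0; lra.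
  lra.
have a2 : 0 < 1 - a ^+ 2 by nra.
have b2 : 0 < 1 - b ^+ 2 by nra.
move: kx ky r2l r2l' s3m s3m' ex3 ey2.
set r1 := d1 - _; set s1 := d1 - _; set r2 := d2 - _; set s2 := d2 - _.
set s3 := d3 - _; set r3 := d3 - _.
(* Row combinations of K v with v = (x1 - y1, - y2, x3): [e12] and [e13] eliminate v1, [e31]
   eliminates v3 and [e21] eliminates v2. *)
have e12 : (s2 - r2) - a * (s1 - r1) = (a ^+ 2 - 1) * y2 + (c - a * b) * x3.
  by rewrite /s2 /r2 /s1 /r1; ring.
have e13 : (s3 - r3) - b * (s1 - r1) = (1 - b ^+ 2) * x3 + (a * b - c) * y2.
  by rewrite /s3 /r3 /s1 /r1; ring.
have e31 : (s1 - r1) - b * (s3 - r3) = (1 - b ^+ 2) * (x1 - y1) - (a - b * c) *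
  y2.
  by rewrite /s3 /r3 /s1 /r1; ring.
have e21 : (s1 - r1) - a * (s2 - r2) = (1 - a ^+ 2) * (x1 - y1) + (b - a * c) *
  x3.
  by rewrite /s2 /r2 /s1 /r1; ring.
move: r1 r2 r3 s1 s2 s3 e12 e13 e31 e21 => r1 r2 r3 s1 s2 s3 e12 e13 e31 e21.
move=> kx ky r2l r2l' s3m s3m' er es; subst r3 s2.
(* Here [p] is the common sign of [x1] and [y1]. For l <= m the left side of [e12] is nonnegative
   and its right side negative; for m < l the left side of [e13] is nonpositive and its right side
   positive. *)
have same_sign p : -1 <= p <= 1 -> s1 - r1 = p * (m - l) -> False.
  move=> p1 e; rewrite e in e12 e13.
  have [lm|ml] := lerP l m.
    have : 0 <= (m - l) * (1 - a * p) by apply: mulr_ge0; [lra|nra].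
    have := mulr_gt0 a2 y2_gt0; have := mulr_gt0 c_lt x3_gt0.
    lra.
  have : 0 <= (l - m) * (1 - b * p) by apply: mulr_ge0; [lra|nra].
  have := mulr_gt0 b2 x3_gt0; have := mulr_gt0 c_lt y2_gt0.
  lra.
have bnd k z : -1 < k < 1 -> `|z| <= m + l -> k * z <= m + l.
  move=> k1 zml; apply: le_trans (ler_norm _) _; rewrite normrM.
  apply: le_trans zml; rewrite ler_piMl // ler_norml; lra.
case/lt_total/orP: x0 => x_sg; case/lt_total/orP: y0 => y_sg.
- apply: (same_sign (- 1)); first lra.
  by rewrite (kkt_coord_lt0 kx) // (kkt_coord_lt0 ky) //; ring.
- move: e31; rewrite (kkt_coord_lt0 kx) // (kkt_coord_gt0 ky) //.
  have : 0 < (1 - b ^+ 2) * - (x1 - y1) by apply: mulr_gt0; lra.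
  have := mulr_gt0 a_gt y2_gt0.
  have := bnd b (s3 - l) b1 _.
  move=> /(_ ltac:(rewrite ler_norml; lra)).
  lra.
- move: e21; rewrite (kkt_coord_gt0 kx) // (kkt_coord_lt0 ky) //.
  have : 0 < (1 - a ^+ 2) * (x1 - y1) by apply: mulr_gt0; lra.
  have := mulr_gt0 b_gt x3_gt0.
  have := bnd a (r2 - m) a1 _.
  move=> /(_ ltac:(rewrite ler_norml; lra)).
  lra.
- apply: (same_sign 1); first lra.
  by rewrite (kkt_coord_gt0 kx) // (kkt_coord_gt0 ky) //; ring.
Qed.

(** Flips make [x2] and [x3] positive. Once [z3] and [w2] are known to be positive as well, the
    correlation inequality of [kkt3_full_corr] contradicts [kkt3_pairs]. *)
Lemma kkt3_full_pairs a b c d1 d2 d3 l x1 x2 x3 m y1 y2 y3 n z1 z3 o w1 w2 :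
  posdef3 a b c ->
  kkt3 a b c d1 d2 d3 l x1 x2 x3 -> kkt3 a b c d1 d2 d3 m y1 y2 y3 ->
  kkt3 a b c d1 d2 d3 n z1 0 z3 -> kkt3 a b c d1 d2 d3 o w1 w2 0 ->
  x1 * y1 < 0 -> 0 < x2 * y2 -> 0 < x3 * y3 ->
  z1 != 0 -> z3 != 0 -> w1 != 0 -> w2 != 0 -> False.
Proof.
wlog x2_gt0 : a c d2 x2 y2 w2 / 0 < x2 => [H|].
  move=> pd kx ky kz kw xy1 xy2.
  have x0 : x2 != 0 by apply: contraTneq xy2 => ->; rewrite mul0r ltxx.
  case/lt_total/orP: x0 => [xN|x_gt0] xy3 z1_neq0 z3_neq0 w1_neq0 w2_neq0;
    last first.
    exact: (H _ _ _ _ _ _ x_gt0 pd kx ky kz kw).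
  move/kkt3_flip2: kz; rewrite oppr0 => kz.
  apply: (H _ _ _ _ _ _ _ _ (kkt3_flip2 kx) (kkt3_flip2 ky) kz (kkt3_flip2 kw))
    => //.
  - by rewrite oppr_gt0.
  - exact: posdef3_flip2.
  - by rewrite mulrNN.
  - by rewrite oppr_eq0.
wlog x3_gt0 : b c d3 x3 y3 z3 / 0 < x3 => [H|].
  move=> pd kx ky kz kw xy1 xy2 xy3.
  have x0 : x3 != 0 by apply: contraTneq xy3 => ->; rewrite mul0r ltxx.
  case/lt_total/orP: x0 => [xN|x_gt0] z1_neq0 z3_neq0 w1_neq0 w2_neq0;
    last first.
    exact: (H _ _ _ _ _ _ x_gt0 pd kx ky kz kw).
  (* Flipping the third coordinate is the flip of the second one conjugated by the transposition of
     both. *)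
  have flip3 := fun A B C D E F L X Y Z k =>
    kkt3_swap (kkt3_flip2 (@kkt3_swap A B C D E F L X Y Z k)).
  have kw' := flip3 _ _ _ _ _ _ _ _ _ _ kw; rewrite oppr0 in kw'.
  apply: (H _ _ _ _ _ _ _ _ (flip3 _ _ _ _ _ _ _ _ _ _ kx)
    (flip3 _ _ _ _ _ _ _ _ _ _ ky) (flip3 _ _ _ _ _ _ _ _ _ _ kz) kw') => //.
  - by rewrite oppr_gt0.
  - exact/posdef3_swap/posdef3_flip2/posdef3_swap.
  - by rewrite mulrNN.
  - by rewrite oppr_eq0.
move=> pd kx ky kz kw xy1;
  rewrite !pmulr_rgt0 // => y2_gt0 y3_gt0 z1_neq0 z3_neq0 w1_neq0 w2_neq0.
(* Since [x1] and [y1] are opposite, [z1] clashes with one of them. A negative [z3] would then be a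
   second clash with the same full point; likewise for [w1] and [w2]. *)
have clash1 u : u != 0 -> x1 * u < 0 \/ y1 * u < 0.
  have : x1 != 0 by apply: contraTneq xy1 => ->; rewrite mul0r ltxx.
  case/lt_total/orP => x_sg; move: xy1.
    rewrite nmulr_rlt0 // => y_sg; rewrite nmulr_rlt0 // pmulr_rlt0 //.
    by case/lt_total/orP => ?; [right|left].
  rewrite pmulr_rlt0 // => y_sg; rewrite pmulr_rlt0 // nmulr_rlt0 //.
  by case/lt_total/orP => ?; [left|right].
have z3_gt0 : 0 < z3.
  case/lt_total/orP: z3_neq0 => // z3_lt0; exfalso.
  have pd' := posdef3_swap12 pd; have kz' := kkt3_swap12 kz.
  by case: (clash1 _ z1_neq0) => h; [
    apply: (kkt3_clash pd' (kkt3_swap12 kx) kz' h)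
  | apply: (kkt3_clash pd' (kkt3_swap12 ky) kz' h)]; left; rewrite pmulr_rlt0.
have w2_gt0 : 0 < w2.
  case/lt_total/orP: w2_neq0 => // w2_lt0; exfalso.
  have pd' := posdef3_swap12 (posdef3_swap pd).
  have kw' := kkt3_swap12 (kkt3_swap kw).
  by case: (clash1 _ w1_neq0) => h; [
    apply: (kkt3_clash pd' (kkt3_swap12 (kkt3_swap kx)) kw' h)
  | apply: (kkt3_clash pd' (kkt3_swap12 (kkt3_swap ky)) kw' h)]; left;
    rewrite pmulr_rlt0.
have corr := kkt3_full_corr pd kx ky xy1 x2_gt0 y2_gt0 x3_gt0 y3_gt0.
exact: (kkt3_pairs pd corr kz kw).
Qed.

End CorrelationMatrix.

(** * The lasso path *)

Section LassoPath.
Variables (R : realType) (N p : nat) (X : 'M[R]_(N, p)) (y : 'cV[R]_N).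
Implicit Types (b g u : 'cV[R]_p) (l m t : R).

Local Notation f := (lasso_objective X y).

Definition resid_corr b : 'cV[R]_p := bvec X y - Kmat X *m b.
Local Notation rc := resid_corr.

Definition Kform u : R := \sum_j u j 0 * (Kmat X *m u) j 0.

Lemma l1norm_ge0 b : 0 <= l1norm b.
Proof. by apply: sumr_ge0 => j _; exact: normr_ge0. Qed.

Lemma l1norm0 : l1norm (0 : 'cV[R]_p) = 0.
Proof. by apply: big1 => j _; rewrite mxE normr0. Qed.

Lemma l1norm0_eq0 b : l1norm b = 0 -> b = 0.
Proof.
move=> /psumr_eq0P b0; apply/colP => j; rewrite mxE.
by apply/eqP; rewrite -normr_eq0; apply/eqP/b0 => // i _; exact: normr_ge0.
Qed.

Lemma l1normD b g : l1norm (b + g) <= l1norm b + l1norm g.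
Proof. by rewrite -big_split; apply: ler_sum => j _; rewrite mxE ler_normD. Qed.

Lemma l1normZ l b : l1norm (l *: b) = `|l| * l1norm b.
Proof. by rewrite /l1norm mulr_sumr; apply: eq_bigr => j _;
  rewrite mxE normrM. Qed.

Lemma l1norm_delta j : l1norm (delta_mx j 0 : 'cV[R]_p) = 1.
Proof.
rewrite /l1norm (bigD1 j) //= big1 ?addr0 ?mxE ?eqxx ?normr1 // => i ij.
by rewrite mxE (negPf ij) normr0.
Qed.

Lemma KmatE i j : Kmat X i j = N%:R^-1 * \sum_k X k i * X k j.
Proof.
rewrite /Kmat mxE summxE; congr (_ * _); apply: eq_bigr => k _.
by rewrite mxE big_ord1 !mxE.
Qed.

Lemma bvecE j : bvec X y j 0 = N%:R^-1 * \sum_k y k 0 * X k j.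
Proof.
rewrite /bvec mxE summxE; congr (_ * _); apply: eq_bigr => k _.
by rewrite !mxE.
Qed.

Lemma KmatC i j : Kmat X i j = Kmat X j i.
Proof. by rewrite !KmatE; congr (_ * _); apply: eq_bigr => k _;
  rewrite mulrC. Qed.

Lemma KformE u : Kform u = N%:R^-1 * \sum_k (\sum_j u j 0 * X k j) ^+ 2.
Proof.
transitivity (\sum_j \sum_i \sum_k N%:R^-1 * ((u j 0 * X k j) * (u i 0 * X k
  i))).
  apply: eq_bigr => j _; rewrite mxE mulr_sumr; apply: eq_bigr => i _.
  rewrite KmatE -[N%:R^-1 * _ * _]mulrA mulr_suml mulrCA !mulr_sumr.
  by apply: eq_bigr => k _; ring.
under eq_bigr => j _ do rewrite exchange_big.
rewrite exchange_big mulr_sumr; apply: eq_bigr => k _ /=.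
rewrite expr2 big_distrlr mulr_sumr; apply: eq_bigr => j _ /=.
by rewrite mulr_sumr.
Qed.

Lemma resid_corrE b j :
  rc b j 0 = N%:R^-1 * \sum_k X k j * (y k 0 - \sum_i b i 0 * X k i).
Proof.
rewrite mxE bvecE mxE mxE.
under [X in _ = _ * X]eq_bigr => k _ do rewrite mulrBr.
rewrite sumrB mulrBr; congr (_ - _).
  by congr (_ * _); apply: eq_bigr => k _; rewrite mulrC.
under [X in _ = _ * X]eq_bigr => k _ do rewrite mulr_sumr.
rewrite exchange_big mulr_sumr; apply: eq_bigr => i _ /=.
rewrite KmatE -mulrA mulr_suml; congr (_ * _).
by apply: eq_bigr => k _; ring.
Qed.

(** The objective is quadratic, so its second-order expansion is exact. The gradient is - N [rc b]
    and the Hessian N K, as K and [bvec] are averages. *)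
Lemma objectiveE b u : (0 < N)%N ->
  f (b + u) = f b - N%:R * \sum_j rc b j 0 * u j 0 + 2^-1 * N%:R * Kform u.
Proof.
move=> N_gt0; have N0 : N%:R != 0 :> R by rewrite pnatr_eq0 -lt0n.
have -> : \sum_j rc b j 0 * u j 0 = N%:R^-1 *
    \sum_k (y k 0 - \sum_i b i 0 * X k i) * (\sum_j u j 0 * X k j).
  under eq_bigr => j _ do rewrite resid_corrE -mulrA mulr_suml.
  rewrite -mulr_sumr exchange_big; congr (_ * _); apply: eq_bigr => k _ /=.
  by rewrite mulr_sumr; apply: eq_bigr => j _; ring.
rewrite KformE mulVKf // -mulrA mulVKf // /lasso_objective !mulr_sumr.
rewrite -sumrB -big_split; apply: eq_bigr => k _ /=.
rewrite (_ : \sum_j (b + u) j 0 * X k j = \sum_j b j 0 * X k j + \sum_j u j 0 *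
  X k j).
  by field.
by rewrite -big_split; apply: eq_bigr => j _; rewrite mxE mulrDl.
Qed.

Lemma resid_corrB b g j : rc g j 0 - rc b j 0 = (Kmat X *m (b - g)) j 0.
Proof. by rewrite /rc mulmxBr !mxE; ring. Qed.

Definition kkt l b := 0 <= l /\ forall j, kkt_coord l (b j 0) (rc b j 0).

Hypothesis data : data_set X y.

Lemma data_size_gt0 : (0 < N)%N.
Proof.
case: N X y data => // X0 y0 [_ /(_ 0 0)].
have h : row_full (0 : 'M[R]_(p + 1)) -> False.
  by rewrite /row_full mxrank0 addn1.
by move=> h2; exfalso; apply/h/h2 => -[].
Qed.

(** If X u = 0, all data points lie in the kernel of the column (u, 0). By full rank this kernel is
    the whole space, hence u = 0. *)
Lemma col_free u : (forall k, \sum_j u j 0 * X k j = 0) -> u = 0.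
Proof.
move=> Xu; case: data => _ /(_ 0 (kermx (col_mx u (0 : 'cV_1)))).
set w := col_mx _ _ => full.
have : row_full (kermx w).
  apply: full => i; rewrite subr0; apply/sub_kermxP.
  rewrite mul_row_col mulmx0 addr0; apply/matrixP => a c;
    rewrite !ord1 [RHS]mxE mxE.
  by rewrite -[RHS](Xu i); apply: eq_bigr => j _; rewrite !mxE mulrC.
rewrite -sub1mx => /sub_kermxP; rewrite mul1mx => w0.
by have := congr1 usubmx w0; rewrite col_mxKu => ->; apply/matrixP => a c;
  rewrite !mxE.
Qed.

Lemma Kform_ge0 u : 0 <= Kform u.
Proof.
by rewrite KformE mulr_ge0 ?invr_ge0 ?ler0n // sumr_ge0 // => k _;
  exact: sqr_ge0.
Qed.

Lemma Kform_gt0 u : u != 0 -> 0 < Kform u.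
Proof.
move=> u0; rewrite lt_neqAle Kform_ge0 andbT eq_sym; apply: contra_neq u0.
rewrite KformE => /eqP;
  rewrite mulf_eq0 invr_eq0 pnatr_eq0 gtn_eqF ?data_size_gt0 //=.
move=> /eqP /psumr_eq0P h; apply: col_free => k; apply/eqP.
by rewrite -sqrf_eq0; apply/eqP/h => // i _; exact: sqr_ge0.
Qed.

Lemma Kmat_unit : Kmat X \in unitmx.
Proof.
rewrite -row_free_unit -kermx_eq0; apply/rowV0P => v /sub_kermxP vK.
apply/eqP; apply/negPn/negP => v0.
have := Kform_gt0 (_ : v^T != 0); rewrite trmx_eq0 => /(_ v0).
have Kv : Kmat X *m v^T = (v *m Kmat X)^T.
  by rewrite trmx_mul; congr (_ *m _); apply/matrixP => i j;
    rewrite [RHS]mxE KmatC.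
by rewrite /Kform Kv vK big1 ?ltxx // => j _; rewrite !mxE mulr0.
Qed.

Lemma resid_corr0 b : rc b = 0 -> b = beta_hat X y.
Proof. by move/subr0_eq => e; rewrite /beta_hat e mulKmx ?Kmat_unit. Qed.

(** Were the slope [s] towards [g] positive, a step towards [g], which stays in the convex l1 ball,
    would decrease the objective. *)
Lemma minimizer_variational t b g : lasso_minimizer X y t b -> l1norm g <= t ->
  \sum_j rc b j 0 * (g - b) j 0 <= 0.
Proof.
move=> [bt bmin] gt; rewrite leNgt; apply/negP => s_gt0.
set s := \sum_j _ in s_gt0.
have q_ge0 := Kform_ge0 (g - b); set q := Kform _ in q_ge0.
(* This step length lies in (0, 1] and satisfies e q = (1 - e) s, so the gain factor s - e q / 2
   equals (1 + e) s / 2 > 0. *)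
pose e := s / (s + q).
have e_gt0 : 0 < e by apply: divr_gt0 => //; lra.
have e_le1 : e <= 1 by rewrite ler_pdivrMr ?mul1r; lra.
have : l1norm (b + e *: (g - b)) <= t.
  have -> : b + e *: (g - b) = (1 - e) *: b + e *: g.
    by rewrite scalerBr scalerBl scale1r addrA addrAC.
  apply: le_trans (l1normD _ _) _;
    rewrite !l1normZ !ger0_norm ?(ltW e_gt0) ?subr_ge0 //.
  have : (1 - e) * l1norm b <= (1 - e) * t by apply: ler_wpM2l; lra.
  have : e * l1norm g <= e * t by apply: ler_wpM2l; lra.
  lra.
move=> /bmin; rewrite objectiveE ?data_size_gt0 //.
have -> : \sum_j rc b j 0 * (e *: (g - b)) j 0 = e * s.
  by rewrite mulr_sumr; apply: eq_bigr => j _; rewrite [X in _ * X]mxE mulrCA.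
have -> : Kform (e *: (g - b)) = e ^+ 2 * q.
  rewrite /q !KformE mulrCA; congr (_ * _); rewrite mulr_sumr;
    apply: eq_bigr => k _.
  rewrite -exprMn mulr_sumr; congr (_ ^+ 2).
  by apply: eq_bigr => j _; rewrite [X in X * _]mxE mulrA.
have N0 : 0 < N%:R :> R by rewrite ltr0n data_size_gt0.
have -> : f b - N%:R * (e * s) + 2^-1 * N%:R * (e ^+ 2 * q) =
  f b - N%:R * e * (s - 2^-1 * e * q) by ring.
suff : 0 < N%:R * e * (s - 2^-1 * e * q) by lra.
apply: mulr_gt0; first exact: mulr_gt0.
have : e * (s + q) = s by rewrite divfK //; lra.
have := mulr_gt0 e_gt0 s_gt0; lra.
Qed.

(** The two variational inequalities add up to [Kform (b - g) <= 0]. *)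
Lemma lasso_minimizer_unique t b g : lasso_minimizer X y t b ->
  lasso_minimizer X y t g -> b = g.
Proof.
move=> bm gm; apply/eqP; rewrite -subr_eq0; apply/negPn/negP => bg.
have := minimizer_variational bm (proj1 gm);
  have := minimizer_variational gm (proj1 bm).
have := Kform_gt0 bg.
have -> : Kform (b - g) =
   \sum_j rc b j 0 * (g - b) j 0 + \sum_j rc g j 0 * (b - g) j 0.
  rewrite -big_split; apply: eq_bigr => j _ /=.
  by rewrite -resid_corrB !mxE; ring.
lra.
Qed.

(** The linear term of the expansion at [b] is controlled by <rc b, g - b> <= l (|g|_1 - |b|_1) <=
    0, and the quadratic term is nonnegative. *)
Lemma kkt_minimizer l b : kkt l b -> lasso_minimizer X y (l1norm b) b.
Proof.
move=> [l0 kb]; split=> // g gb.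
rewrite -(subrKC b g) objectiveE ?data_size_gt0 //.
have N0 : 0 < N%:R :> R by rewrite ltr0n data_size_gt0.
have : 0 <= N%:R * Kform (g - b) by rewrite mulr_ge0 ?Kform_ge0 ?ltW.
suff : N%:R * \sum_j rc b j 0 * (g - b) j 0 <= 0 by lra.
apply: mulr_ge0_le0; first exact: ltW.
have -> : \sum_j rc b j 0 * (g - b) j 0 = \sum_j (rc b j 0 * g j 0 - l * `|b j
  0|).
  by apply: eq_bigr => j _; rewrite !mxE -(proj2 (kb j)) !mxE; ring.
rewrite sumrB -mulr_sumr subr_le0; apply: (@le_trans _ _ (l * l1norm g)).
  rewrite mulr_sumr; apply: ler_sum => j _; apply: le_trans (ler_norm _) _.
  by rewrite normrM ler_wpM2r ?normr_ge0 //; case: (kb j).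
exact: ler_wpM2l.
Qed.

Lemma lassoE t b : lasso_minimizer X y t b -> lasso X y t = b.
Proof. by move=> bm; apply: xget_unique => // g gm;
  apply: lasso_minimizer_unique gm bm. Qed.

Lemma kkt_lasso l b : kkt l b -> lasso X y (l1norm b) = b.
Proof. by move/kkt_minimizer/lassoE. Qed.

(** From the interior of the ball one can move along [rc b], the descent direction. The variational
    inequality then forces [rc b = 0], so [b] is [beta_hat], whose norm is at least [t]. *)
Lemma minimizer_l1norm t b : t <= t_hat X y -> lasso_minimizer X y t b ->
  l1norm b = t.
Proof.
move=> t_le bm; apply/eqP; rewrite eq_le (proj1 bm) leNgt; apply/negP => b_lt.
have b_rc e : 0 < e -> l1norm (b + e *: rc b) <= t -> rc b = 0.
  move=> e_gt0 /(minimizer_variational bm); rewrite [b + _ - b]addrC addKr => h.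
  have {}h : \sum_j rc b j 0 ^+ 2 = 0.
    apply/eqP; rewrite eq_le sumr_ge0 ?andbT; last by move=> j _;
      exact: sqr_ge0.
    rewrite -(pmulr_rle0 _ e_gt0); move: h; congr (_ <= 0).
    by rewrite mulr_sumr; apply: eq_bigr => j _; rewrite [X in _ * X = _]mxE;
      ring.
  apply/colP => j; rewrite [RHS]mxE; apply/eqP; rewrite -sqrf_eq0; apply/eqP.
  by apply: (psumr_eq0P _ h) => // i _; exact: sqr_ge0.
have b_ge0 := l1norm_ge0 (rc b).
have : rc b = 0.
  apply: (b_rc ((t - l1norm b) / (1 + l1norm (rc b)))).
    by apply: divr_gt0; lra.
  apply: le_trans (l1normD _ _) _; rewrite l1normZ ger0_norm; last first.
    by apply: divr_ge0; lra.
  rewrite -lerBrDl mulrAC ler_pdivrMr; last lra.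
  by apply: ler_wpM2l; lra.
move/resid_corr0 => bE; move: b_lt; rewrite bE => /lt_le_trans /(_ t_le).
by rewrite ltxx.
Qed.

(** The multiplier is l = <rc b, b> / t. Testing against the vertices of the l1 ball bounds each
    |r_j| by l; the terms l |b_j| - r_j b_j are then nonnegative with sum l t - <rc b, b> = 0. *)
Lemma minimizer_kkt t b : 0 < t <= t_hat X y -> lasso_minimizer X y t b ->
  exists l, kkt l b.
Proof.
move=> /andP[t_gt0 t_le] bm; have bt := minimizer_l1norm t_le bm.
pose s := \sum_j rc b j 0 * b j 0; pose l := s / t.
have rc_le j : `|rc b j 0| <= l.
  rewrite ler_pdivlMr //.
  have := @minimizer_variational t b ((Num.sg (rc b j 0) * t) *: delta_mx j 0)
    bm.
  have -> : l1norm ((Num.sg (rc b j 0) * t) *: delta_mx j 0 : 'cV[R]_p) <= t.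
    rewrite l1normZ l1norm_delta mulr1 normrM normr_sg (gtr0_norm t_gt0).
    by case: (rc b j 0 == 0); rewrite ?mul0r ?mul1r // ltW.
  move=> /(_ isT).
  have -> : \sum_i rc b i 0 * ((Num.sg (rc b j 0) * t) *: delta_mx j 0 - b) i 0
    = `|rc b j 0| * t - s.
    under eq_bigr => i _ do rewrite [X in _ * X]mxE mulrDr.
    rewrite big_split /=; congr (_ + _).
      rewrite (bigD1 j) //= big1 ?addr0.
        rewrite [X in _ * X]mxE [X in _ * (_ * X)]mxE !eqxx mulr1.
        by rewrite [in RHS]normrEsg; ring.
      move=> i ij; rewrite [X in _ * X]mxE [X in _ * (_ * X)]mxE (negPf ij).
      by rewrite !mulr0.
    by rewrite -sumrN; apply: eq_bigr => i _; rewrite [X in _ * X]mxE mulrN.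
  by rewrite subr_le0.
have l_ge0 : 0 <= l.
  have [/eqP p0|] := boolP (p == 0)%N.
    rewrite /l /s big1 ?mul0r // => j _.
    by have := ltn_ord j; rewrite {2}p0.
  by rewrite -lt0n => p0; apply: le_trans (rc_le (Ordinal p0)).
exists l; split=> // j; split; first exact: rc_le.
apply/eqP; rewrite -subr_eq0 -oppr_eq0 opprB; apply/eqP.
apply: (@psumr_eq0P _ _ predT (fun j => l * `|b j 0| - rc b j 0 * b j 0)) => //.
  move=> i _; rewrite subr_ge0; apply: le_trans (ler_norm _) _.
  by rewrite normrM ler_wpM2r.
by rewrite sumrB -mulr_sumr [X in _ * X]bt /l divfK ?subrr // gt_eqF.
Qed.

End LassoPath.

Lemma card_finset (T : finType) (A : {set T}) : ([set` A] #= `I_#|A|)%card.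
Proof.
rewrite card_eq_sym cardE.
case E : (enum A) => [|x0 s].
  rewrite (_ : [set` A] = set0) /= ?card_eq0; first by apply/eqP;
    rewrite -subset0 => -[].
  by apply/seteqP; split=> // x /=; rewrite -mem_enum E.
rewrite -E (_ : [set` A] = nth x0 (enum A) @` `I_(size (enum A))).
  apply/card_esym/inj_card_eq => i j; rewrite !inE /= => ilt jlt /eqP.
  by rewrite nth_uniq ?enum_uniq // => /eqP.
apply/seteqP; split=> [x /=|_ [i /= ilt <-]].
  rewrite -mem_enum => xA; exists (index x (enum A));
    first by rewrite /= index_mem.
  by rewrite nth_index.
by rewrite -mem_enum mem_nth.
Qed.

Lemma continuous_sumr (R : realType) (T : topologicalType) (I : finType) (F : I
  -> T -> R) :
  (forall i, continuous (F i)) -> continuous (fun x => \sum_i F i x).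
Proof.
by move=> cF; apply: continuous_big => //; exact: add_continuous.
Qed.

(** On numbers of one sign the absolute value is linear, so the optimality conditions pass to convex
    combinations. *)
Lemma kkt_coord_convex (R : realType) (l m th x y r s : R) :
  0 <= th <= 1 -> Num.sg x = Num.sg y -> kkt_coord l x r -> kkt_coord m y s ->
  [/\ Num.sg ((1 - th) * x + th * y) = Num.sg x,
      `|(1 - th) * x + th * y| = (1 - th) * `|x| + th * `|y| &
      kkt_coord ((1 - th) * l + th * m) ((1 - th) * x + th * y) ((1 - th) * r +
        th * s)].
Proof.
have pos_case u v : 0 <= th <= 1 -> 0 < u -> 0 < v -> 0 < (1 - th) * u + th * v.
  move=> th01 u0 v0; have [uv|vu] := lerP u v.
    have : th * u <= th * v by apply: ler_wpM2l; lra.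
    lra.
  have : (1 - th) * v <= (1 - th) * u by apply: ler_wpM2l; lra.
  lra.
move=> th01 xy kx ky;
  have rs_le : `|(1 - th) * r + th * s| <= (1 - th) * l + th * m.
  have [th0 th1] : 0 <= th /\ 0 <= 1 - th by lra.
  apply: le_trans (ler_normD _ _) _;
    rewrite !normrM (ger0_norm th0) (ger0_norm th1).
  by case: kx => ? _; case: ky => ? _; apply: lerD; apply: ler_wpM2l => //; lra.
suff [-> zE eqr] : [/\ Num.sg ((1 - th) * x + th * y) = Num.sg x,
    `|(1 - th) * x + th * y| = (1 - th) * `|x| + th * `|y| &
    ((1 - th) * r + th * s) * ((1 - th) * x + th * y)
      = ((1 - th) * l + th * m) * `|(1 - th) * x + th * y|] by [].
case: (ltgtP x 0) xy => [x0|x0|->].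
- rewrite (ltr0_sg x0) => /esym/eqP; rewrite sgr_cp0 => y0.
  have z0 : (1 - th) * x + th * y < 0.
    have := pos_case (- x) (- y) th01; rewrite !oppr_gt0 => /(_ x0 y0); lra.
  by rewrite ltr0_sg // !ltr0_norm // (kkt_coord_lt0 kx) // (kkt_coord_lt0 ky)
    //; split=> //; ring.
- rewrite (gtr0_sg x0) => /esym/eqP; rewrite sgr_cp0 => y0.
  have z0 : 0 < (1 - th) * x + th * y by exact: pos_case.
  by rewrite gtr0_sg // !gtr0_norm // (kkt_coord_gt0 kx) // (kkt_coord_gt0 ky).
- rewrite sgr0 => /esym/eqP; rewrite sgr_eq0 => /eqP ->.
  by rewrite !mulr0 addr0 sgr0 normr0 !mulr0 addr0.
Qed.

(** * Existence of the path and its segments as levels of the sign vector *)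

Section LassoSegments.
Variables (R : realType) (N p : nat) (X : 'M[R]_(N, p)) (y : 'cV[R]_N).
Hypothesis data : data_set X y.
Implicit Types (b g u : 'cV[R]_p) (l m s t : R).

Local Notation L := (lasso X y).
Local Notation th := (t_hat X y).

(** Extreme value theorem on the compact l1 ball, transported to row vectors. *)
Lemma minimizer_exists t : 0 <= t -> exists b, lasso_minimizer X y t b.
Proof.
move=> t0; pose A := [set v : 'rV[R]_p | l1norm v^T <= t].
have coordc j : continuous (fun v : 'rV[R]_p => v^T j 0).
  by under eq_fun do rewrite mxE; exact: coord_continuous.
have [||| b bA bmin] :=
  @compact_EVT_min _ R (fun v => lasso_objective X y v^T) A.
- by exists 0; rewrite /A /= trmx0 l1norm0.
- apply: bounded_closed_compact.
    exists t; split; first exact: num_real.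
    move=> M tM v /= vt; rewrite [leLHS]/Num.Def.normr /= mx_normrE.
    apply: bigmax_le => [|[i j] _ /=]; first exact: le_trans t0 (ltW tM).
    apply: le_trans (ltW tM); apply: le_trans vt;
      rewrite /l1norm (bigD1 j) //= mxE !ord1.
    by rewrite lerDl sumr_ge0.
  apply: (@preimage_closed _ _ (fun v : 'rV[R]_p => l1norm v^T) [set x
    | x <= t]).
    move=> v _; apply: continuous_sumr => j w.
    apply: (@continuous_comp _ _ _ (fun v : 'rV[R]_p => v^T j 0) (@Num.norm R
      R)).
      exact: coordc.
    exact: norm_continuous.
  exact: closed_le.
- apply: continuous_subspaceT.
  have sqr_cont : continuous
      (fun v : 'rV[R]_p => \sum_k (y k 0 - \sum_j v^T j 0 * X k j) ^+ 2).
    apply: continuous_sumr => k w.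
    apply: (@continuous_comp _ _ _ (fun v : 'rV[R]_p => y k 0 - \sum_j v^T j 0
      * X k j)
      (fun x => x ^+ 2)); last exact: exprn_continuous.
    apply: (@continuousB _ _ _ (fun=> y k 0) (fun v : 'rV[R]_p => \sum_j v^T j
      0 * X k j)).
      exact: cst_continuous.
    apply: continuous_sumr => j u.
    apply: (@continuousM _ _ (fun v : 'rV[R]_p => v^T j 0) (fun=> X k j)).
      exact: coordc.
    exact: cst_continuous.
  move=> v; apply: (@continuousM _ _ (fun=> 2^-1) (fun v : 'rV[R]_p =>
    \sum_k (y k 0 - \sum_j v^T j 0 * X k j) ^+ 2)); last exact: sqr_cont.
  exact: cst_continuous.
rewrite inE /A /= in bA; exists b^T; split=> // g gt.
by have := bmin g^T; rewrite inE /A /= trmxK; apply.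
Qed.

Lemma lassoP t : 0 <= t -> lasso_minimizer X y t (L t).
Proof. by move=> /minimizer_exists; exact: xgetPex. Qed.

Lemma lasso_l1norm t : 0 <= t <= th -> l1norm (L t) = t.
Proof. by move=> /andP[t0 tth]; apply: (minimizer_l1norm data tth);
  exact: lassoP. Qed.

Lemma lasso_kkt t : 0 < t <= th -> exists l, kkt X y l (L t).
Proof.
move=> t_in; have /andP[t0 _] := t_in.
exact: (minimizer_kkt data t_in (lassoP (ltW t0))).
Qed.

Lemma kkt_convex l m r b g : 0 <= r <= 1 -> sign_vector b = sign_vector g ->
  kkt X y l b -> kkt X y m g ->
  [/\ sign_vector ((1 - r) *: b + r *: g) = sign_vector b,
      l1norm ((1 - r) *: b + r *: g) = (1 - r) * l1norm b + r * l1norm g &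
      kkt X y ((1 - r) * l + r * m) ((1 - r) *: b + r *: g)].
Proof.
move=> r01 bg [l0 kb] [m0 kg].
have bgj j : Num.sg (b j 0) = Num.sg (g j 0).
  by have /colP/(_ j) := bg; rewrite !mxE.
have comb j : ((1 - r) *: b + r *: g) j 0 = (1 - r) * b j 0 + r * g j 0 by
  rewrite !mxE.
have conv j := kkt_coord_convex r01 (bgj j) (kb j) (kg j).
split.
- by apply/colP => j; rewrite [LHS]mxE comb [RHS]mxE; case: (conv j).
- rewrite /l1norm !mulr_sumr -big_split; apply: eq_bigr => j _ /=.
  by rewrite comb; case: (conv j).
- split=> [|j]; first by apply: addr_ge0; apply: mulr_ge0 => //; lra.
  rewrite comb; case: (conv j) => _ _; congr kkt_coord.
  by rewrite /resid_corr mulmxDr -!scalemxAr !mxE; ring.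
Qed.

(** A copy of [sign_vector] in a finite type, so that the occurring signs form a finite set. *)
Definition sign_code b : {ffun 'I_p -> option bool} :=
  [ffun j => if b j 0 == 0 then None else Some (0 < b j 0)].

Lemma sign_codeP b g : sign_code b = sign_code g <-> sign_vector b =
  sign_vector g.
Proof.
split=> [/ffunP e|/colP e];
  [apply/colP|apply/ffunP] => j; move: (e j); rewrite !(ffunE, mxE).
  case: (ltgtP (b j 0) 0) => bj; case: (ltgtP (g j 0) 0) => gj //= _.
  - by rewrite !ltr0_sg.
  - by rewrite !gtr0_sg.
  - by rewrite bj gj.
by move=> ebg; rewrite -(sgr_eq0 (b j 0)) -(sgr_gt0 (b j 0)) ebg sgr_eq0
  sgr_gt0.
Qed.

Definition code_level c : set R := [set t
  | 0 <= t <= th /\ sign_code (L t) = c].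

(** Two distinct parameters are required because segments have positive length; a code met only at
    one vertex is left out. *)
Definition segment_codes : {set {ffun 'I_p -> option bool}} :=
  [set c | `[< exists s t, [/\ code_level c s, code_level c t & s < t] >]]%SET.

Lemma segment_codesP c :
  reflect (exists s t, [/\ code_level c s, code_level c t & s < t]) (c \in
    segment_codes).
Proof. by rewrite inE; exact: asboolP. Qed.

(** At parameter 0 the code is zero, but the code is shared with a positive parameter, where the
    estimate has positive norm. *)
Lemma segment_codes_neq0 c t : c \in segment_codes -> code_level c t -> 0 < t.
Proof.
case/segment_codesP=> s [s' [[/andP[s0 sth] sc] [/andP[s'0 s'th] s'c] ss']]
  [/andP[t0 tth] tc].
rewrite lt_neqAle t0 andbT; apply/eqP => e.
have Lt : L t = 0 by apply: l1norm0_eq0; rewrite lasso_l1norm ?t0 // -e.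
have : l1norm (L s') = 0.
  have : sign_code (L s') = sign_code 0 by rewrite s'c -tc Lt.
  move/ffunP => h; apply: big1 => j _; have := h j; rewrite !ffunE mxE eqxx.
  by case: eqP => [->|//]; rewrite normr0.
rewrite lasso_l1norm ?s'0 //; lra.
Qed.

(** The convex combination of the estimates at [s] and [t] with norm [z] satisfies the optimality
    conditions, so it is the estimate at [z], and it keeps the sign vector. *)
Lemma code_level_interval c : c \in segment_codes -> is_interval (code_level c).
Proof.
move=> cs s t sL tL z /andP[sz zt].
have s0 := segment_codes_neq0 cs sL; have t0 := segment_codes_neq0 cs tL.
case: sL tL => /andP[_ sth] sc [/andP[_ tth] tc].
have [e|st] := eqVneq s t.
  have -> : z = s by apply/eqP; rewrite eq_le sz andbT e.
  by split; rewrite ?(ltW s0).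
have {}st : s < t by rewrite lt_neqAle st; lra.
have [l kl] : exists l, kkt X y l (L s) by apply: lasso_kkt; rewrite s0.
have [m km] : exists m, kkt X y m (L t) by apply: lasso_kkt; rewrite t0.
pose r := (z - s) / (t - s).
have r01 : 0 <= r <= 1.
  by rewrite divr_ge0 ?ler_pdivrMr /=; lra.
have sgE : sign_vector (L s) = sign_vector (L t) by apply/sign_codeP;
  rewrite sc.
have [sgz lz /(kkt_lasso data) kz] := kkt_convex r01 sgE kl km.
have zE : z = (1 - r) * s + r * t.
  by rewrite /r; field; lra.
split; first lra.
rewrite -sc; apply/sign_codeP; rewrite -sgz -{1}kz lz.
by rewrite !lasso_l1norm -?zE //; lra.
Qed.

Lemma code_level_segment c : c \in segment_codes ->
  lasso_segment X y (code_level c).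
Proof.
move=> cs; have /segment_codesP[s [t [sc tc st]]] := cs.
split; first split.
- exact: code_level_interval.
- by move=> u [u0 _]; rewrite /= in_itv.
- by exists s, t.
- by move=> u v [_ uc] [_ vc]; apply/sign_codeP; rewrite uc.
move=> J [_ Jth _ Jsg] cJ; apply/seteqP; split=> // u Ju; split.
  by have := Jth _ Ju; rewrite /= in_itv.
by case: sc (cJ _ sc) => _ <- Js; apply/sign_codeP; exact: Jsg.
Qed.

Lemma segment_code_level I : lasso_segment X y I ->
  exists2 c, c \in segment_codes & I = code_level c.
Proof.
move=> [[_ Ith [s [t [Is It st]]] Isg] Imax].
have Ic : I `<=` code_level (sign_code (L s)).
  move=> u Iu; split; first by have := Ith _ Iu; rewrite /= in_itv.
  by apply/sign_codeP; exact: Isg.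
have cs : sign_code (L s) \in segment_codes.
  by apply/segment_codesP; exists s, t; split=> //; exact: Ic.
exists (sign_code (L s)) => //; apply/esym/Imax => //.
by have [] := code_level_segment cs.
Qed.

(** [code_level] maps [segment_codes] bijectively onto the segments; it is injective because these
    levels are nonempty. *)
Lemma card_lasso_segments : ([set I
  | lasso_segment X y I] #= `I_#|segment_codes|)%card.
Proof.
have -> : [set I | lasso_segment X y I] = code_level @` [set` segment_codes].
  apply/seteqP; split=> [I /segment_code_level[c cs ->]|_ [c cs <-]].
    by exists c.
  exact: code_level_segment.
apply: card_eq_trans (card_finset _); apply: inj_card_eq => c d;
  rewrite !inE /=.
move=> cs _ e; have /segment_codesP[s [_ [sc _ _]]] := cs.
by have := sc; rewrite e => -[_ <-]; case: sc.
Qed.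

End LassoSegments.

(** * Normalized data with three predictors *)

Section SignCodeTheory.
Variables (R : realType) (p : nat).
Implicit Types (b g : 'cV[R]_p) (i : 'I_p).

Lemma sign_code_bool b i : (sign_code b i : bool) = (b i 0 != 0).
Proof. by rewrite ffunE; case: eqP. Qed.

Lemma sign_code_clash b g i : clash (sign_code b i) (sign_code g i) ->
  b i 0 * g i 0 < 0.
Proof.
rewrite /clash !ffunE; case: (ltgtP (b i 0) 0) => bi;
  case: (ltgtP (g i 0) 0) => gi //= _.
  by rewrite nmulr_rlt0.
by rewrite pmulr_rlt0.
Qed.

Lemma sign_code_same b g i : sign_code b i -> sign_code b i = sign_code g i ->
  0 < b i 0 * g i 0.
Proof.
rewrite !ffunE; case: (ltgtP (b i 0) 0) => bi;
  case: (ltgtP (g i 0) 0) => gi //= _ _.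
  by rewrite nmulr_rgt0.
by rewrite pmulr_rgt0.
Qed.

End SignCodeTheory.

Lemma sum_uniq3 (R : realType) (F : 'I_3 -> R) i j k : uniq [:: i; j; k] ->
  \sum_l F l = F i + F j + F k.
Proof.
move=> ijk; rewrite (perm_big [:: i; j; k]) /=;
  first by rewrite !big_cons big_nil addr0 addrA.
apply: uniq_perm => [||l]; [exact: index_enum_uniq|by []|].
by rewrite mem_index_enum uniq3_mem.
Qed.

Section Normalized3.
Variables (R : realType) (N : nat) (X : 'M[R]_(N, 3)) (y : 'cV[R]_N).
Hypotheses (data : data_set X y) (norm1 : normalized X).

(** Any ordering of the coordinates is allowed, so that the scalar lemmas, written for fixed
    positions, apply to every arrangement. *)
Lemma Kmat_posdef3 i j k : uniq [:: i; j; k] ->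
  posdef3 (Kmat X i j) (Kmat X i k) (Kmat X j k).
Proof.
move=> ijk x1 x2 x3 nz.
have [ij ik jk ji [ki kj]] := uniq3_neq ijk.
pose u : 'cV[R]_3 := \col_l (if l == i then x1 else if l == j then x2 else x3).
have [ui uj uk] : [/\ u i 0 = x1, u j 0 = x2 & u k 0 = x3].
  by rewrite !mxE !eqxx ji ki kj.
have u0 : u != 0.
  apply: contraL nz => /eqP u0; rewrite -ui -uj -uk u0 !mxE eqxx //.
have := Kform_gt0 data u0; rewrite /Kform (sum_uniq3 _ ijk) ![(_ *m _) _ _]mxE.
rewrite !(sum_uniq3 _ ijk) ui uj uk !norm1 (KmatC X j i) (KmatC X k i) (KmatC X
  k j).
by congr (0 < _); ring.
Qed.

Lemma kkt_kkt3 l b i j k : uniq [:: i; j; k] -> kkt X y l b ->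
  kkt3 (Kmat X i j) (Kmat X i k) (Kmat X j k) (bvec X y i 0) (bvec X y j 0)
    (bvec X y k 0)
    l (b i 0) (b j 0) (b k 0).
Proof.
move=> ijk [_ kb].
have rcE h : resid_corr X y b h 0 =
    bvec X y h 0 - (Kmat X h i * b i 0 + Kmat X h j * b j 0 + Kmat X h k * b k
      0).
  by rewrite /resid_corr [LHS]mxE [X in _ + X]mxE [X in _ - X]mxE (sum_uniq3 _
    ijk).
have := kb i; have := kb j; have := kb k.
rewrite !rcE !norm1 !mul1r (KmatC X j i) (KmatC X k i) (KmatC X k j) => kk kj
  ki.
by split.
Qed.

Let attained (c : {ffun 'I_3 ->
  option bool}) := exists l b, kkt X y l b /\ sign_code b = c.

Lemma segment_codes_attained c : c \in segment_codes X y ->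
  attained c /\ [exists i, (c i : bool)].
Proof.
move=> cs; have /segment_codesP[s [_ [sc _ _]]] := cs.
have s0 := segment_codes_neq0 data cs sc; case: sc => /andP[_ sth] sc.
split.
  have [l kl] : exists l, kkt X y l (lasso X y s) by apply: lasso_kkt;
    rewrite ?s0.
  by exists l, (lasso X y s).
apply: contraT; rewrite negb_exists => /forallP c0.
have : l1norm (lasso X y s) = 0.
  apply: big1 => j _; have := c0 j; rewrite -sc sign_code_bool negbK => /eqP ->.
  by rewrite normr0.
by rewrite (lasso_l1norm data) ?(ltW s0) // => e; rewrite e ltxx in s0.
Qed.

Lemma attained_clash c d i j k : attained c -> attained d -> uniq [:: i; j;
  k] ->
  clash (c j) (d j) -> clash (c k) (d k) || ~~ c k && ~~ d k -> False.
Proof.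
move=> [l [b [kb <-]]] [m [g [kg <-]]] ijk /sign_code_clash bgj ck.
apply: (kkt3_clash (Kmat_posdef3 ijk) (kkt_kkt3 ijk kb) (kkt_kkt3 ijk kg) bgj).
case/orP: ck => [/sign_code_clash|]; first by left.
by rewrite !sign_code_bool !negbK => /andP[/eqP bk /eqP gk]; right.
Qed.

Lemma attained_single c d i j k : attained c -> attained d -> uniq [:: i; j;
  k] ->
  [&& c i : bool, ~~ c j & ~~ c k] -> [&& ~~ d i, d j : bool & ~~ d k] -> False.
Proof.
move=> [l [b [kb <-]]] [m [g [kg <-]]] ijk; rewrite !sign_code_bool !negbK.
move=> /and3P[bi /eqP bj /eqP bk] /and3P[/eqP gi gj /eqP gk].
have := kkt_kkt3 ijk kb; have := kkt_kkt3 ijk kg;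
  rewrite bj bk gi gk => kg3 kb3.
exact: (kkt3_singletons (Kmat_posdef3 ijk) bi gj kb3 kg3).
Qed.

Lemma attained_pairs c d e f i j k : attained c -> attained d -> attained e ->
  attained f ->
  uniq [:: i; j; k] -> clash (c i) (d i) ->
  (c j : bool) -> c j = d j -> (c k : bool) -> c k = d k ->
  [&& e i : bool, ~~ e j & e k : bool] ->
    [&& f i : bool, f j : bool & ~~ f k] -> False.
Proof.
move=> [l [b [kb <-]]] [m [g [kg <-]]] [n [z [kz <-]]] [q [w [kw <-]]] ijk.
move=> /sign_code_clash ci cj cdj ck cdk.
have {cj cdj} bgj := sign_code_same cj cdj;
  have {ck cdk} bgk := sign_code_same ck cdk.
rewrite !sign_code_bool !negbK => /and3P[zi /eqP zj zk] /and3P[wi wj /eqP wk].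
have := kkt_kkt3 ijk kz; have := kkt_kkt3 ijk kw; rewrite zj wk => kw3 kz3.
exact: (kkt3_full_pairs (Kmat_posdef3 ijk) (kkt_kkt3 ijk kb) (kkt_kkt3 ijk kg)
  kz3 kw3).
Qed.

Lemma card_segment_codes : (#|segment_codes X y| <= 5)%N.
Proof.
have att c : c \in segment_codes X y ->
  attained c by move/segment_codes_attained => [].
apply: card_sign_codes.
- by move=> c /segment_codes_attained[].
- by move=> c d i j k /att ac /att ad; exact: attained_clash.
- by move=> c d i j k /att ac /att ad; exact: attained_single.
- by move=> c d e f i j k /att ac /att ad /att ae /att af;
    exact: attained_pairs.
Qed.

End Normalized3.

(** * Normalized data whose path has five segments of positive length *)

Section SharpExample.
Variable R : realType.

(* The rows [(x, y)]: with [z] ranging over the vectors [2 e_k] and [- 2 e_k]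
   of R^4, [x = ((z1 + 2 z2 + 2 z3) / 3, z2, z3)] and
   [y = - 21 x1 + 30 x2 + 27 x3 + z4]. *)
Definition ex_rows : seq (seq R) :=
  [:: [:: 2 / 3; 0; 0; - 14]; [:: 4 / 3; 2; 0; 32];
      [:: 4 / 3; 0; 2; 26]; [:: 0; 0; 0; 2];
      [:: - (2 / 3); 0; 0; 14]; [:: - (4 / 3); - 2; 0; - 32];
      [:: - (4 / 3); 0; - 2; - 26]; [:: 0; 0; 0; - 2]].

Definition ex_data : 'M[R]_(8, 3 + 1) := \matrix_(k, j) (nth [::] ex_rows k)`_j.
Definition ex_X : 'M[R]_(8, 3) := lsubmx ex_data.
Definition ex_y : 'cV[R]_8 := rsubmx ex_data.

Lemma ex_data_point i : data_point ex_X ex_y i = row i ex_data.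
Proof. by rewrite /data_point -row_row_mx hsubmxK. Qed.

Lemma ex_dataset : data_set ex_X ex_y.
Proof.
split.
  apply/rowP => j; rewrite summxE [RHS]mxE.
  under eq_bigr => i _ do rewrite ex_data_point !mxE.
  rewrite !big_ord_recl big_ord0 /=.
  by case: j => [[|[|[|[|]]]] //= jlt]; ring.
move=> v V sub.
(* Rows k and k + 4 are antipodal, so half their difference is row k and the translation [v]
   cancels. *)
have subV (k : 'I_4) : (row (lshift 4 k) ex_data <= V)%MS.
  have -> : row (lshift 4 k) ex_data =
      2^-1 *: ((data_point ex_X ex_y (lshift 4 k) - v)
               - (data_point ex_X ex_y (rshift 4 k) - v)).
    rewrite !ex_data_point opprB addrA subrK; apply/rowP => j; rewrite !mxE /=.
    by case: k => [[|[|[|[|]]]] //= klt]; case: j => [[|[|[|[|]]]] //= jlt];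
      field.
  by apply: scalemx_sub; apply: addmx_sub; rewrite ?eqmx_opp; exact: sub.
rewrite -sub1mx; apply/row_subP => i.
pose r k : 'rV[R]_(3 + 1) := row (lshift 4 (inord k : 'I_4)) ex_data.
have combV a b c d :
    ((a *: r 0%N + b *: r 1%N + c *: r 2%N + d *: r 3%N)%R <= V)%MS.
  have scV x k : (x *: r k <= V)%MS by apply: scalemx_sub; exact: subV.
  by apply: addmx_sub => //; apply: addmx_sub => //; exact: addmx_sub.
(* The four lists are the columns of the inverse of the matrix formed by the first four rows. *)
have -> : row i 1%:M =
    nth 0 [:: 3 / 2; - 1; - 1; 0] i *: r 0%N +
    nth 0 [:: 0; 1 / 2; 0; 0] i *: r 1%N +
    nth 0 [:: 0; 0; 1 / 2; 0] i *: r 2%N +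
    nth 0 [:: 21 / 2; - 15; - 27 / 2; 1 / 2] i *: r 3%N.
  apply/rowP => j; rewrite !mxE /= !inordK //.
  by case: i => [[|[|[|[|]]]] //= ilt]; case: j => [[|[|[|[|]]]] //= jlt];
    field.
exact: combV.
Qed.

Lemma ex_normalized : normalized ex_X.
Proof.
move=> j; rewrite KmatE !big_ord_recl big_ord0 !mxE /=.
by case: j => [[|[|[|]]] //= jlt]; field.
Qed.

Definition vec3 (a b c : R) : 'cV[R]_3 := \col_j [:: a; b; c]`_j.

Lemma ex_kkt l a b c : 0 <= l ->
  kkt_coord l a (17 - a - 2 / 3 * b - 2 / 3 * c) ->
  kkt_coord l b (16 - 2 / 3 * a - b) ->
  kkt_coord l c (13 - 2 / 3 * a - c) -> kkt ex_X ex_y l (vec3 a b c).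
Proof.
move=> l0 ka kb kc; split=> // j;
  rewrite resid_corrE !big_ord_recl !big_ord0 !mxE /=.
case: j => [[|[|[|]]] //= jlt].
- by move: ka; congr kkt_coord; field.
- by move: kb; congr kkt_coord; field.
- by move: kc; congr kkt_coord; field.
Qed.

Lemma l1norm_vec3 a b c : l1norm (vec3 a b c) = `|a| + `|b| + `|c|.
Proof. by rewrite /l1norm !big_ord_recl big_ord0 !mxE /= addr0 addrA. Qed.

Lemma ex_t_hat : t_hat ex_X ex_y = 78.
Proof.
rewrite /t_hat -(resid_corr0 ex_dataset (_ : resid_corr ex_X ex_y (vec3 (- 21)
  30 27) = 0)).
  by rewrite l1norm_vec3 normrN !ger0_norm //; ring.
apply/colP => j; rewrite resid_corrE !big_ord_recl !big_ord0 !mxE /=.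
by case: j => [[|[|[|]]] //= jlt]; field.
Qed.

Definition code3 (u v w : option bool) : {ffun 'I_3 -> option bool} :=
  [ffun j => nth None [:: u; v; w] (val j)].

(** Collects what one coordinate contributes: its optimality condition, its sign code and its
    summand of the l1 norm. *)
Definition coord_spec (l x r : R) (u : option bool) (n : R) : Prop :=
  [/\ kkt_coord l x r, (if x == 0 then None else Some (0 < x)) = u & `|x| = n].

Lemma coord_pos l x r : 0 <= l -> 0 < x -> r = l ->
  coord_spec l x r (Some true) x.
Proof.
move=> l0 x0 ->; split; rewrite ?gt_eqF ?x0 ?gtr0_norm //.
by split; rewrite ger0_norm // ltW.
Qed.

Lemma coord_neg l x r : 0 <= l -> x < 0 -> r = - l ->
  coord_spec l x r (Some false) (- x).
Proof.
move=> l0 x0 ->; split; last by rewrite ltr0_norm.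
  by split; [rewrite normrN ger0_norm|rewrite ltr0_norm // mulrN mulNr].
by rewrite lt_eqF // ltNge (ltW x0).
Qed.

Lemma coord_zero l r : - l <= r <= l -> coord_spec l 0 r None 0.
Proof.
rewrite -ler_norml => rl; split; rewrite ?eqxx ?normr0 //.
by split; rewrite // normr0 !mulr0.
Qed.

Lemma ex_code_level l a b c u v w m n o : 0 <= l ->
  coord_spec l a (17 - a - 2 / 3 * b - 2 / 3 * c) u m ->
  coord_spec l b (16 - 2 / 3 * a - b) v n ->
  coord_spec l c (13 - 2 / 3 * a - c) w o -> m + n + o <= 78 ->
  code_level ex_X ex_y (code3 u v w) (m + n + o).
Proof.
move=> l0 [ka au am] [kb bv bn] [kc cw co] t78.
have := kkt_lasso ex_dataset (ex_kkt l0 ka kb kc);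
  rewrite l1norm_vec3 am bn co => lasso_t.
split.
  by rewrite ex_t_hat t78 andbT -am -bn -co !addr_ge0.
rewrite lasso_t; apply/ffunP => -[[|[|[|]]] //= jlt]; rewrite !ffunE !mxE //=.
Qed.

Definition ex_codes : seq {ffun 'I_3 -> option bool} :=
  [:: code3 (Some true) None None; code3 (Some true) (Some true) None;
      code3 (Some true) (Some true) (Some true);
      code3 None (Some true) (Some true);
      code3 (Some false) (Some true) (Some true)].

Lemma ex_codes_uniq : uniq ex_codes.
Proof.
apply: (@map_uniq _ _ (fun c : {ffun 'I_3 -> option bool} => (c 0, c 1, c 2))).
by rewrite /= !ffunE.
Qed.

Local Ltac ex_coord :=
  first [apply: coord_pos | apply: coord_neg | apply: coord_zero | idtac]; lra.

Lemma ex_codes_segment c : c \in ex_codes -> c \in segment_codes ex_X ex_y.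
Proof.
move=> cE; apply/segment_codesP; rewrite !inE in cE.
(* For each code two points of its segment are exhibited with their penalty [l]. The parameters are
   written as sums of absolute values of the coordinates, in the shape that [ex_code_level]
   expects. *)
case/or4P: cE => [| | |/orP[]] /eqP ->.
- exists (1 + 0 + 0), (3 + 0 + 0); split; last lra.
    by apply: (@ex_code_level 16 1 0 0); ex_coord.
  by apply: (@ex_code_level 14 3 0 0); ex_coord.
- exists (4 + 1 + 0), (6 + 3 + 0); split; last lra.
    by apply: (@ex_code_level (37 / 3) 4 1 0); ex_coord.
  by apply: (@ex_code_level 9 6 3 0); ex_coord.
- exists (9 / 2 + 9 / 2 + 3 / 2), (3 + 6 + 3); split; last lra.
    by apply: (@ex_code_level (17 / 2) (9 / 2) (9 / 2) (3 / 2)); ex_coord.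
  by apply: (@ex_code_level 8 3 6 3); ex_coord.
- exists (0 + 9 + 6), (0 + 15 + 12); split; last lra.
    by apply: (@ex_code_level 7 0 9 6); ex_coord.
  by apply: (@ex_code_level 1 0 15 12); ex_coord.
- exists (- - (21 / 2) + 45 / 2 + 39 / 2), (- - 21 + 30 + 27); split; last lra.
    by apply: (@ex_code_level (1 / 2) (- (21 / 2)) (45 / 2) (39 / 2)); ex_coord.
  by apply: (@ex_code_level 0 (- 21) 30 27); ex_coord.
Qed.

Lemma ex_card_segment_codes : #|segment_codes ex_X ex_y| = 5%N.
Proof.
apply/eqP; rewrite eqn_leq (card_segment_codes ex_dataset ex_normalized) /=.
rewrite cardE -[5%N]/(size ex_codes);
  apply: uniq_leq_size ex_codes_uniq _ => c cE.
by rewrite mem_enum ex_codes_segment.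
Qed.

End SharpExample.

Theorem proposition7p1 (R : realType) :
  [/\ (forall (N : nat) (X : 'M[R]_(N, 3)) (y : 'cV[R]_N),
         data_set X y -> normalized X ->
         exists2 n : nat, total_complexity X y n & (n <= 6)%N),
      (exists (N : nat) (X : 'M[R]_(N, 3)) (y : 'cV[R]_N),
         [/\ data_set X y, normalized X & total_complexity X y 6]),
      Nbar3 = 7%N
    & (6 < Nbar3)%N].
Proof.
split; rewrite ?Nbar3E //.
  (* The successor counts the degenerate segment at the origin. *)
  move=> N X y data norm1; exists #|segment_codes X y|.+1.
    by exists #|segment_codes X y|; first exact: card_lasso_segments.
  by rewrite ltnS; exact: card_segment_codes.
exists 8, (ex_X R), (ex_y R).
split; [exact: ex_dataset|exact: ex_normalized|].
exists 5 => //; have := card_lasso_segments (ex_dataset R).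
by rewrite ex_card_segment_codes.
Qed.
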